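(* Let $V$ be a $\mathbb{C}$-vector space of dimension $n$ and let $u:V\to V$ be a nilpotent endomorphism whose Young diagram $Y=Y(u)$ has two columns of lengths $r\geq s$. Let $T\in\mathcal{T}(Y)$ be a standard tableau and let $T'\in\mathcal{T}'(Y)$ be a row-standard tableau. The following conditions are equivalent. (a) $F_{T'}\in\mathcal{K}^T$. (b) $s_{j/i}(T')\leq s_{j/i}^T$ for any $0\leq i<j\leq n$.
   Context: Springer fiber: $\mathcal{B}_u$ is the projective variety of complete flags $F=(V_0\subset V_1\subset\dots\subset V_n=V)$, $\dim V_i=i$, with $u(V_i)\subset V_i$ for all $i$. Young diagrams: for a nilpotent endomorphism $v$, $Y(v)$ is the Young diagram whose rows have lengths equal to the sizes (in weakly decreasing order) of the Jordan blocks of $v$. Here $Y=Y(u)$ has $n$ boxes and two columns of lengths $r\geq s\geq 1$, so $n=r+s$. Standard tableaux and components: a standard tableau of shape $Y$ is a numbering of the boxes of $Y$ by $1,\dots,n$ (each used once) increasing in each row from left to right and in each column from top to bottom; $\mathcal{T}(Y)$ is the set of these. For $T\in\mathcal{T}(Y)$ let $Y_i^T$ be the shape of the subtableau of $T$ formed by the boxes with entries $1,\dots,i$. Put $\mathcal{B}_u^T=\{(V_0,\dots,V_n)\in\mathcal{B}_u: Y(u_{|V_i})=Y_i^T\ \text{for all } i\}$ and let $\mathcal{K}^T=\overline{\mathcal{B}_u^T}$ be its Zariski closure (it is known to be an irreducible component of $\mathcal{B}_u$, and every component is of this form). Row-standard tableaux and flags $F_{T'}$: a row-standard tableau of shape $Y$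 is a numbering of the boxes of $Y$ by $1,\dots,n$ (each used once) increasing in each row from left to right; $\mathcal{T}'(Y)$ is the set of these. Fix a Jordan basis $(e_1,\dots,e_n)$ of $V$ with $u(e_i)=0$ for $i\leq r$ and $u(e_i)=e_{i-r}$ for $i\geq r+1$; the vectors $e_1,\dots,e_r$ are associated to the boxes of the first column of $Y$ from top to bottom, and $e_{r+1},\dots,e_n$ to the boxes of the second column from top to bottom. For $T'\in\mathcal{T}'(Y)$, $F_{T'}=(V_0,\dots,V_n)\in\mathcal{B}_u$ is the flag where $V_i$ is spanned by the basis vectors associated to the boxes containing the entries $1,\dots,i$ of $T'$. The numbers $s_{j/i}(T')$: let $a'_1,\dots,a'_r$ (resp. $b'_1,\dots,b'_s$) be the entries from top to bottom of the first (resp. second) column of $T'\in\mathcal{T}'(Y)$. For $0\leq i<j\leq n$ set $s_{j/i}(T')=\#\{p: 1\leq p\leq s \text{ and } i<a'_p<b'_p\leq j\}$. The numbers $s_{j/i}^T$: let $T\in\mathcal{T}(Y)$ and let $a_1<\dots<a_r$ (resp. $b_1<\dots<b_s$) be the entries of the first (resp. second) column of $T$. Define a reordering $a_1^*,\dots,a_r^*$ of $a_1,\dots,a_r$ as follows: $a_1^*=b_1-1$; if $a_1^*,\dots,a_{p-1}^*$ have been constructed and $p\leq s$, then $a_p^*$ is the maximal element among those $a\in\{a_1,\dots,a_r\}\setminus\{a_1^*,\dots,a_{p-1}^*\}$ with $a<b_p$; for $p>s$, $a_p^*=\min\,\{a_1,\dots,a_r\}\setminus\{a_1^*,\dots,a_{p-1}^*\}$.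 For $0\leq i<j\leq n$ set $s_{j/i}^T=\#\{p: 1\leq p\leq s \text{ and } i<a_p^*<b_p\leq j\}$. $\#A$ denotes the number of elements of a set $A$. *)

(* Defs.v *)
From HB Require Import structures.
From mathcomp Require Import all_boot all_order all_algebra.
From mathcomp Require Import mpoly.

Set Implicit Arguments.
Unset Strict Implicit.
Unset Printing Implicit Defensive.

Import GRing.Theory.
Local Open Scope ring_scope.

(* All indices are shifted to start at 0: boxes of a diagram, basis vectors
   and columns are numbered from 0.  Tableau entries still run through
   1, ..., n. *)

(* Tableaux.  A Young diagram is the sequence of its row lengths; a
   tableau is the sequence of its rows. *)

Definition two_columns (r s : nat) : seq nat := (nseq s 2 ++ nseq (r - s) 1)%N.

Definition entry (T : seq (seq nat)) (p q : nat) : nat := nth 0%N (nth [::] T p) q.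

Definition row_standard (Y : seq nat) (T : seq (seq nat)) : Prop :=
  [/\ shape T = Y,
      perm_eq (flatten T) (iota 1 (sumn Y)) &
      forall p q, (q.+1 < nth 0 Y p)%N -> (entry T p q < entry T p q.+1)%N].

Definition standard (Y : seq nat) (T : seq (seq nat)) : Prop :=
  row_standard Y T /\
  forall p q, (q < nth 0 Y p.+1)%N -> (entry T p q < entry T p.+1 q)%N.

Definition subshape (T : seq (seq nat)) (i : nat) : seq nat :=
  [seq l <- [seq count (fun x => x <= i)%N row | row <- T] | (0 < l)%N].

Definition column (T : seq (seq nat)) (q : nat) : seq nat :=
  [seq nth 0%N row q | row <- T & (q < size row)%N].

Definition s_rowstd (T : seq (seq nat)) (i j : nat) : nat :=
  let a := column T 0 in let b := column T 1 in
  count (fun p => [&& i < nth 0 a p, nth 0 a p < nth 0 b p & nth 0 b p <= j])%N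
        (iota 0 (size b)).

(* The first m terms of the reordering a^* of a. *)
Fixpoint reorder (a b : seq nat) (m : nat) : seq nat :=
  if m is p.+1 then
    let prev := reorder a b p in
    let rest := [seq x <- a | x \notin prev] in
    rcons prev
      (if p == 0%N then (nth 0 b 0).-1
       else if (p < size b)%N then \max_(x <- rest | (x < nth 0 b p)%N) x
       else head 0 (sort leq rest))%N
  else [::].

Definition s_std (T : seq (seq nat)) (i j : nat) : nat :=
  let a := column T 0 in let b := column T 1 in
  let a' := reorder a b (size a) in
  count (fun p => [&& i < nth 0 a' p, nth 0 a' p < nth 0 b p & nth 0 b p <= j])%N
        (iota 0 (size b)).

Section Linear.

Variables (K : fieldType) (V : vectType K).

Definition nilpotent_end (u : 'End(V)) : Prop :=
  exists k : nat, forall x : V, iter k u x = 0.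

(* Y(u|_W) = Y: the u-stable subspace W has a Jordan basis (x p q), one block
   x p 0, ..., x p (Y_p - 1) for each row p of Y. *)
Definition young_diagram_of (u : 'End(V)) (W : {vspace V}) (Y : seq nat) : Prop :=
  [/\ sorted geq Y, all (fun l => 0 < l)%N Y &
  exists x : nat -> nat -> V,
    basis_of W [seq x p q | p <- iota 0 (size Y), q <- iota 0 (nth 0%N Y p)] /\
    forall p q, (p < size Y)%N -> (q < nth 0 Y p)%N ->
      u (x p q) = if q is q'.+1 then x p q' else 0].

Variable n : nat.
Implicit Types (F : 'I_n.+1 -> {vspace V}) (e : n.-tuple V).

Definition complete_flag F : Prop :=
  (forall i, \dim (F i) = i :> nat) /\
  (forall i j : 'I_n.+1, (i <= j)%N -> (F i <= F j)%VS).

Definition springer_fiber (u : 'End(V)) F : Prop :=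
  complete_flag F /\ forall i, (u @: F i <= F i)%VS.

(* Zariski topology on the variety of complete flags, embedded in the
   product over k of the projective spaces P(\Lambda^k V). *)

(* Homogeneous coordinate of F indexed by I, with k = #|I|: the maximal minor
   on the columns I of the coordinates in e of a basis of F k.  Another basis
   multiplies the whole block of coordinates #|I| = k by one nonzero scalar;
   another e acts on each block by a linear automorphism, so that the topology
   below does not depend on e. *)
Definition plucker e F (I : {set 'I_n}) : K :=
  \det (\matrix_(a < #|I|, b < #|I|)
          coord e (enum_val b) (vbasis (F (inord #|I|)))`_a).

Definition plucker_point e F : 'I_#|{set 'I_n}| -> K :=
  fun l => plucker e F (enum_val l).

(* Homogeneous in each block of variables {X_I : #|I| = k} separately. *)
Definition multihomogeneous (P : {mpoly K[#|{set 'I_n}|]}) : Prop :=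
  exists d : nat -> nat, forall m, m \in msupp P ->
    forall k, (\sum_(l < #|{set 'I_n}| | #|enum_val l : {set 'I_n}| == k) m l)%N = d k.

Definition zariski_closure e (Z : ('I_n.+1 -> {vspace V}) -> Prop) F : Prop :=
  complete_flag F /\
  forall P : {mpoly K[#|{set 'I_n}|]}, multihomogeneous P ->
    (forall G, Z G -> P.@[plucker_point e G] = 0) ->
    P.@[plucker_point e F] = 0.

Definition springer_stratum (u : 'End(V)) (T : seq (seq nat)) F : Prop :=
  springer_fiber u F /\ forall i, young_diagram_of u (F i) (subshape T i).

(* Closure taken inside the Springer fiber. *)
Definition springer_component e (u : 'End(V)) (T : seq (seq nat)) F : Prop :=
  springer_fiber u F /\ zariski_closure e (springer_stratum u T) F.

Definition jordan_basis (r s : nat) (u : 'End(V)) e : Prop :=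
  [/\ basis_of fullv e,
      forall k, (k < r)%N -> u e`_k = 0 &
      forall k, (k < s)%N -> u e`_(r + k) = e`_k].

Definition tableau_flag (r s : nat) e (T : seq (seq nat)) : 'I_n.+1 -> {vspace V} :=
  fun i =>
    <<[seq e`_p | p <- iota 0 r & (entry T p 0 <= i)%N] ++
      [seq e`_(r + p) | p <- iota 0 s & (entry T p 1 <= i)%N]>>%VS.

End Linear.

(* Main.v *)
Require Import Defs.
From HB Require Import structures.
From mathcomp Require Import all_boot all_order all_algebra.
From mathcomp Require Import perm mpoly.
From mathcomp Require Import reals complex.
From mathcomp Require Import zify.

(* A flag spanned by a basis (x_c) with u x_c = x_(p c) or 0, for an involution p
   of the positions, is encoded by the arcs {p c < c} of p; F_T' is such a flag,
   and the flags whose arcs end exactly at the entries of the second column of T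
   lie in the stratum of T.

   Let first(i, k] and second(k, j] be the numbers of entries of the two columns
   of T in the intervals.  The greedy construction of a^* gives
     s^T_(j/i) = min over i <= k <= j of (first(i, k] + second(k, j]),
   and s_(j/i)(T') counts the arcs of T' inside (i, j].

   (a) => (b).  On the stratum, dim (V_i + u V_j) <= i + first(i, k] + second(k, j].
   This persists in the closure: some minor of a spanning family of V_i + u V_j,
   written with contractions of the Pluecker vectors of V_i and V_j, is a
   multihomogeneous polynomial in the Pluecker coordinates.

   (b) => (a).  If the arcs of p satisfy the bound, but do not end at the entries
   of the second column, let m be the first mismatch.  For a suitable l > m,
   conjugating p by (m l) preserves the bound, and the flags of pattern p are
   limits, for t -> 0, of flags of the conjugated pattern: replace x_m by
   x_m + t x_l.  Iterating this ends at a pattern whose flags are in the stratum. *)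

Set Implicit Arguments.
Unset Strict Implicit.
Unset Printing Implicit Defensive.

(** * Link patterns *)

Lemma leq_sum_nat n (E1 E2 : nat -> nat) : (forall c, c < n -> E1 c <= E2 c) ->
  \sum_(0 <= c < n) E1 c <= \sum_(0 <= c < n) E2 c.
Proof. by move=> le12; rewrite !big_mkord; apply: leq_sum => c _; apply: le12. Qed.

(** Conditions are summed as 0 or 1, so that splitting or comparing counts reduces to a pointwise
    relation between booleans, within reach of [lia]. *)
Definition cnt (n : nat) (P : pred nat) : nat := \sum_(0 <= c < n) (P c : nat).

Lemma leq_cnt n (P Q : pred nat) : (forall c, c < n -> P c -> Q c) -> cnt n P <= cnt n Q.
Proof.
move=> PQ; apply: leq_sum_nat => c cn.
by have := PQ c cn; case: (P c) => //= ->.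
Qed.

Lemma eq_cnt n (P Q : pred nat) : (forall c, c < n -> P c = Q c) -> cnt n P = cnt n Q.
Proof. by move=> PQ; apply: eq_big_nat => c /= cn; rewrite PQ. Qed.

Lemma leq_cntD n (P Q R : pred nat) : (forall c, c < n -> P c <= Q c + R c) ->
  cnt n P <= cnt n Q + cnt n R.
Proof.
by move=> PQ; rewrite /cnt -big_split; apply: leq_sum_nat => c cn; apply: PQ.
Qed.

Lemma geq_cntD n (P Q R : pred nat) : (forall c, c < n -> Q c + R c <= P c) ->
  cnt n Q + cnt n R <= cnt n P.
Proof.
by move=> PQ; rewrite /cnt -big_split; apply: leq_sum_nat => c cn; apply: PQ.
Qed.

Lemma eq_cntD n (P Q R : pred nat) : (forall c, c < n -> P c = Q c + R c :> nat) ->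
  cnt n P = cnt n Q + cnt n R.
Proof.
move=> PQ; apply/eqP; rewrite eqn_leq leq_cntD ?geq_cntD // => c cn.
all: by rewrite PQ.
Qed.

Lemma cnt_pred1 n m : m < n -> cnt n (pred1 m) = 1.
Proof.
move=> mn; rewrite /cnt (bigD1_seq m) ?mem_index_iota ?iota_uniq //= eqxx.
by rewrite big1 // => c /negbTE ->.
Qed.

Lemma cnt_itv n i j : j <= n -> cnt n (fun c => i <= c < j) = j - i.
Proof.
elim: j => [|j IH] jn; first by rewrite /cnt big1 // => c _; lia.
case: (leqP i j) => ij; last first.
  by rewrite /cnt big1 ?(eqP _) //; [rewrite (_ : j.+1 - i = 0) //; lia| move=> c _; lia].
have -> : j.+1 - i = (j - i) + 1 by lia.
rewrite -IH; last lia.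
rewrite -(@cnt_pred1 n j) //; apply: eq_cntD => c cn /=; lia.
Qed.

Definition link_pattern (n : nat) (p : nat -> nat) : Prop :=
  involutive p /\ forall c, c < n -> p c < n.

Lemma reindex_cnt n p P : link_pattern n p -> cnt n (P \o p) = cnt n P.
Proof.
move=> [pK pn]; rewrite /cnt /index_iota subn0.
have permE : perm_eq (iota 0 n) (map p (iota 0 n)).
  rewrite perm_sym; apply: uniq_perm.
  - by rewrite map_inj_uniq ?iota_uniq //; apply: inv_inj.
  - exact: iota_uniq.
  move=> c; rewrite mem_iota /=; apply/mapP/idP => [[d]|cn].
    by rewrite mem_iota => dn ->; have := pn d; lia.
  by exists (p c); rewrite ?pK // mem_iota; have := pn c; lia.
by rewrite [RHS](perm_big _ permE) big_map.
Qed.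

Definition swap (m l c : nat) : nat := if c == m then l else if c == l then m else c.

Lemma swapK m l : involutive (swap m l).
Proof. by move=> c; rewrite /swap; do !case: ifP => //=; lia. Qed.

Definition conj_swap (m l : nat) (p : nat -> nat) (c : nat) := swap m l (p (swap m l c)).

Lemma link_pattern_swap n m l : m < n -> l < n -> link_pattern n (swap m l).
Proof. by move=> mn ln; split; [exact: swapK|move=> c cn; rewrite /swap; do !case: ifP]. Qed.

Lemma link_pattern_conj n m l p : m < n -> l < n ->
  link_pattern n p -> link_pattern n (conj_swap m l p).
Proof.
move=> mn ln [pK pn]; have [_ sn] := link_pattern_swap mn ln.
split=> [c|c cn]; first by rewrite /conj_swap swapK pK swapK.
by rewrite /conj_swap sn // pn // sn.
Qed.

(* In these configurations conjugating p by (m l), m < l, moves p up for the order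
   comparing the numbers of arcs inside every interval: an arc (m, p m) or (p l, l)
   over a fixed point shrinks, or two arcs cease to cross. *)
Definition raising (p : nat -> nat) (m l : nat) : Prop :=
  ((p m = m \/ l < p m) /\ (p l = l \/ p l < m)) \/ (l < p m /\ p m < p l).

(** * Dominated patterns and the descent on the first mismatch *)

Section Descent.
Variables (n : nat) (b : pred nat).

(** Position c carries the entry c + 1, so the positions [i, j) stand for the entries in (i, j]. An
    arc is counted at its right end. *)
Definition arcs (p : nat -> nat) i j := cnt n (fun c => [&& i <= p c, p c < c & c < j]).
Definition nb_first i k := cnt n (fun c => (i <= c < k) && ~~ b c).
Definition nb_second k j := cnt n (fun c => (k <= c < j) && b c).

(** Condition (b) for p, with s^T replaced by the minimum over k that computes it. *)
Definition dominated (p : nat -> nat) : Prop :=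
  forall i k j, i <= k <= j -> j <= n -> arcs p i j <= nb_first i k + nb_second k j.

Lemma arcs_open p i j : link_pattern n p ->
  arcs p i j = cnt n (fun c => [&& i <= c, c < p c & p c < j]).
Proof.
move=> pp; rewrite -(reindex_cnt _ pp) /=; apply: eq_cnt => c cn /=.
by rewrite (proj1 pp).
Qed.

Lemma nb_first_split i k j : i <= k <= j -> nb_first i j = nb_first i k + nb_first k j.
Proof. by move=> ikj; apply: eq_cntD => c cn; lia. Qed.

Lemma nb_second_split i k j : i <= k <= j -> nb_second i j = nb_second i k + nb_second k j.
Proof. by move=> ikj; apply: eq_cntD => c cn; lia. Qed.

Lemma nb_first_second i j : j <= n -> nb_first i j + nb_second i j = j - i.
Proof. by move=> jn; rewrite -(cnt_itv i jn); apply/esym/eq_cntD => c cn; lia. Qed.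

Lemma nb_secondS m : m < n -> b m -> nb_second m m.+1 = 1.
Proof.
by move=> mn bm; rewrite -(cnt_pred1 mn); apply: eq_cnt => c cn /=;
  case: (eqVneq c m) => [->|]; lia.
Qed.

Lemma nb_firstS m : m < n -> b m -> nb_first m m.+1 = 0.
Proof. by move=> mn bm; have := nb_first_second m mn; rewrite nb_secondS //; lia. Qed.

(* The bound through k splits at the position m, where b counts one more than p. *)
Lemma arcs_slack_across p m z i j k : link_pattern n p -> dominated p -> m < n -> b m ->
  (forall c, c < m -> b c = (p c < c)) ->
  z < m -> m <= p z -> i <= z -> m < j <= n ->
  (forall c, m <= c < j -> p c < c -> m < p c) -> i <= k <= j ->
  (arcs p i j).+1 <= nb_first i k + nb_second k j.
Proof.
move=> pp H mn bm agr zm mpz iz mjn noC ikj.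
have split_arcs : arcs p i j <= arcs p i m + arcs p m.+1 j.
  by apply: leq_cntD => c cn; have := noC c; lia.
(* For k <= m the slack comes from the second-column entry at m; for k > m it comes from z, which
   opens an arc not contained in [i, m). *)
case: (leqP k m) => km.
  have := H i k m; have := H m.+1 m.+1 j.
  rewrite (@nb_second_split k m j) ?(@nb_second_split m m.+1 j) ?nb_secondS //; try lia.
  have -> : nb_first m.+1 m.+1 = 0 by rewrite /nb_first /cnt big1 // => c _; lia.
  lia.
have open_le : arcs p i m + 1 <= nb_first i m.
  rewrite arcs_open // -(@cnt_pred1 n z); last lia.
  apply: geq_cntD => c cn /=.
  have := agr c; case: (eqVneq c z) => [->|]; lia.
have := H m.+1 k j.
rewrite (@nb_first_split i m k) ?(@nb_first_split m m.+1 k) ?nb_firstS //; lia.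
Qed.

(* The positions of [m, i) open arcs ending before j or close arcs opened there,
   so that the interval [m, j) contains many more arcs than [i, j). *)
Lemma arcs_slack_nested p m l i j k : link_pattern n p -> dominated p -> m < n -> b m ->
  m < l < p m -> (forall c, m < c < l -> c < p c < p m \/ m < p c < c) ->
  m < i <= l -> p m < j <= n -> i <= k <= j ->
  (arcs p i j).+1 <= nb_first i k + nb_second k j.
Proof.
move=> pp H mn bm mlp nest mil pmj ikj.
(* The arcs opened in [m, i) are contained in [m, j) but not in [i, j). *)
set O := cnt n (fun c => (m <= c < i) && (c < p c)).
have h1 : arcs p i j + O <= arcs p m j.
  rewrite !arcs_open //; apply: geq_cntD => c cn.
  by have := nest c; case: (eqVneq c m) => [->|]; lia.
have h3 : i - m = O + arcs p m i.
  rewrite -(@cnt_itv n m i); last lia.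
  apply: eq_cntD => c cn; have := nest c.
  by case: (eqVneq c m) => [->|]; lia.
have := H m k j; have := H m m.+1 i; have := @nb_first_second m i.
rewrite (@nb_first_split m i k) ?(@nb_second_split m m.+1 i) ?nb_firstS ?nb_secondS //; lia.
Qed.

(** The excluded hypothesis makes the arcs inside [m, p m] match all its positions. The bounds with
    k = m + 1 and k = p m + 1 add up to one less than its length, because m lies in the second
    column. *)
Lemma nested_block_absurd p m : link_pattern n p -> dominated p -> m < n -> b m -> m < p m ->
  ~ (forall c, m < c < p m -> c < p c < p m \/ m < p c < c).
Proof.
move=> pp H mn bm mpm nest; set y := p m in mpm nest *.
have yn : y < n by apply: (proj2 pp).
have pym : p y = m by rewrite /y (proj1 pp).
have h : y.+1 - m = arcs p m y.+1 + arcs p m y.+1.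
  rewrite -(@cnt_itv n m y.+1) // [in X in X + _]arcs_open //.
  apply: eq_cntD => c cn; have := nest c.
  case: (eqVneq c m) => [->|]; first by rewrite -/y; lia.
  case: (eqVneq c y) => [->|]; first by rewrite pym; lia.
  lia.
have := H m m.+1 y.+1; have := H m y.+1 y.+1; have := @nb_first_second m y.+1.
have -> : nb_second y.+1 y.+1 = 0 by rewrite /nb_second /cnt big1 // => c _; lia.
rewrite (@nb_second_split m m.+1 y.+1) ?nb_firstS ?nb_secondS //; lia.
Qed.


Lemma arcs_conj p m l i j : link_pattern n p -> m < n -> l < n ->
  arcs (conj_swap m l p) i j =
  cnt n (fun c => [&& i <= swap m l (p c), swap m l (p c) < swap m l c & swap m l c < j]).
Proof.
move=> pp mn ln; rewrite /arcs -(reindex_cnt _ (link_pattern_swap mn ln)).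
by apply: eq_cnt => c cn; rewrite /= /conj_swap swapK.
Qed.

(** An interval can gain only (p l, m), when it does not contain (p l, l), or (l, p m), when it does
    not contain (m, p m). The last two terms record these cases. *)
Lemma arcs_conj_le p m l i j : link_pattern n p -> m < l < n -> raising p m l ->
  arcs (conj_swap m l p) i j <= arcs p i j +
    ([&& p l < m, i <= p l & m < j <= l] + [&& l < p m, m < i <= l & p m < j]).
Proof.
move=> pp mln mv; have [pK pn] := pp.
rewrite arcs_conj //; try lia.
set g1 := [&& p l < m, _ & _]; set g2 := [&& l < p m, _ & _].
have bnd x (g : bool) : cnt n (fun c => (c == x) && g) <= g.
  case: g; last by rewrite /cnt big1 // => c _; rewrite andbF.
  case: (ltnP x n) => xn; last by rewrite /cnt big_nat_cond big1 // => c; lia.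
  by rewrite -[X in _ <= X](cnt_pred1 xn); apply: leq_cnt => c _ /=; rewrite andbT.
(* After the reindexing by the swap, the two possible new arcs are seen at the positions l and p
   m. *)
apply: leq_trans (leq_add (leqnn _) (leq_add (bnd l g1) (bnd (p m) g2))).
rewrite /arcs /cnt -!big_split; apply: leq_sum_nat => c cn /=.
have or3 (x y z w : bool) : (x -> [|| y, z | w]) -> x <= y + (z + w).
  by case: x => [/(_ isT)|_ //]; case: y; case: z; case: w.
apply: or3 => /and3P[].
have e1 : (p c == m) = (c == p m) by rewrite (can2_eq pK pK).
have e2 : (p c == l) = (c == p l) by rewrite (can2_eq pK pK).
have pKm := pK m; have pKl := pK l.
rewrite /swap e1 e2 /g1 /g2.
case: (eqVneq c m) => [cm|cm].
  by subst c; case: mv => [[[?|?] [?|?]]|[? ?]]; do ?case: ifP => ?; lia.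
case: (eqVneq c l) => [cl|cl].
  by subst c; case: mv => [[[?|?] [?|?]]|[? ?]]; do ?case: ifP => ?; lia.
by case: mv => [[[?|?] [?|?]]|[? ?]]; do ?case: ifP => ?; lia.
Qed.

Lemma arcs_conj_total p m l : link_pattern n p -> m < l < n -> raising p m l ->
  arcs (conj_swap m l p) 0 n = arcs p 0 n.
Proof.
move=> pp mln mv; have [pK pn] := pp.
rewrite arcs_conj //; try lia.
apply: eq_cnt => c cn.
have := (link_pattern_swap (_ : m < n) (_ : l < n)).2 c cn => /(_ _ _)-> //; try lia.
rewrite cn !andbT /=.
have e1 : (p c == m) = (c == p m) by rewrite (can2_eq pK pK).
have e2 : (p c == l) = (c == p l) by rewrite (can2_eq pK pK).
have pKm := pK m; have pKl := pK l.
rewrite /swap e1 e2.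
case: (eqVneq c m) => [cm|cm].
  by subst c; case: mv => [[[?|?] [?|?]]|[? ?]]; do ?case: ifP => ?; lia.
case: (eqVneq c l) => [cl|cl].
  by subst c; case: mv => [[[?|?] [?|?]]|[? ?]]; do ?case: ifP => ?; lia.
by case: mv => [[[?|?] [?|?]]|[? ?]]; do ?case: ifP => ?; lia.
Qed.

(** The two gains exclude each other, since together they give j <= l < p m < j; hence a slack of
    one suffices. *)
Lemma dominated_conj p m l : link_pattern n p -> m < l < n -> raising p m l -> dominated p ->
  (forall i k j, i <= k <= j -> j <= n ->
    [&& p l < m, i <= p l & m < j <= l] || [&& l < p m, m < i <= l & p m < j] ->
    (arcs p i j).+1 <= nb_first i k + nb_second k j) ->
  dominated (conj_swap m l p).
Proof.
move=> pp mln mv H gain i k j ikj jn.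
have := gain i k j ikj jn; have := H i k j ikj jn.
have := @arcs_conj_le p m l i j pp mln mv; lia.
Qed.

(** With no arc over the fixed point m, every arc lies in [0, m) or [m + 1, n). The bounds there
    miss the second-column entry at m, against the equality of the totals. *)
Lemma exists_arc_over p m : link_pattern n p -> dominated p -> m < n -> b m -> p m = m ->
  arcs p 0 n = nb_second 0 n -> exists2 l, m < l < n & p l < m.
Proof.
move=> pp H mn bm pm tot.
case: (boolP (has (fun l => (m < l) && (p l < m)) (iota 0 n))) => [/hasP[l]|/hasPn no].
  by rewrite mem_iota => ? /andP[? ?]; exists l => //; lia.
have le_split : arcs p 0 n <= arcs p 0 m + arcs p m.+1 n.
  apply: leq_cntD => c cn; have := no c; rewrite mem_iota.
  have : c <> m -> p c <> m by move=> cm e; apply: cm; rewrite -(proj1 pp c) e.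
  case: (eqVneq c m) => [->|]; lia.
have := H 0 0 m; have := H m.+1 m.+1 n.
have z i : nb_first i i = 0 by rewrite /nb_first /cnt big1 // => c _; lia.
move: tot; rewrite (@nb_second_split 0 m n) ?(@nb_second_split m m.+1 n) ?nb_secondS ?z //; lia.
Qed.

(** [Q] will be the vanishing of a polynomial on all flags of a pattern; it is carried back from the
    conjugated pattern to p. *)
Theorem descent (Q : (nat -> nat) -> Prop) :
  (forall p, link_pattern n p -> (forall c, c < n -> b c = (p c < c)) -> Q p) ->
  (forall p m l, link_pattern n p -> m < l < n -> raising p m l -> Q (conj_swap m l p) -> Q p) ->
  forall p, link_pattern n p -> dominated p -> arcs p 0 n = nb_second 0 n -> Q p.
Proof.
move=> Q0 QS.
(* Each step makes m agree with b, or turns m from open to fixed, or lengthens the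
   arc opened at m; positions before m keep agreeing. *)
pose key (p : nat -> nat) m := if m < p m then (n - p m).+1 else (p m == m : nat).
(* As [key] is at most n + 1, the weight n + 2 makes the measure lexicographic in n - m and
   [key]. *)
suff gen N : forall p m, link_pattern n p -> dominated p -> arcs p 0 n = nb_second 0 n ->
    m <= n -> (forall c, c < m -> b c = (p c < c)) ->
    (n - m) * n.+2 + key p m <= N -> Q p.
  by move=> p *; apply: (gen _ p 0).
elim: N => [|N IH] p m pp H tot mn agr meas.
  by apply: Q0 => // c cn; apply: agr; lia.
case: (eqVneq m n) => [emn|nmn]; first by apply: Q0 => // c cn; apply: agr; lia.
have {}mn : m < n by lia.
case: (eqVneq (b m) (p m < m)) => [bpm|bpm].
  apply: (IH p m.+1) => // [c cm|].
    by case: (eqVneq c m) => [->|ncm]; [exact: bpm|apply: agr; lia].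
  have key_le : key p m.+1 <= n.+1 by rewrite /key; case: ifP => ?; [lia|case: eqP].
  move: meas; have -> : n - m = (n - m.+1).+1 by lia.
  by rewrite mulSn; lia.
(* If instead m closed an arc without being in the second column, [0, m + 1) would have more arcs
   than second-column entries, against the bound with i = k = 0. *)
have [bm Cm] : b m /\ m <= p m.
  have := H 0 0 m.+1; rewrite /nb_first [X in X + _](_ : _ = 0); last first.
    by rewrite /cnt big1 // => c _; lia.
  have : ~~ b m -> p m < m -> nb_second 0 m.+1 < arcs p 0 m.+1.
    move=> bm pmm; rewrite /nb_second /arcs -addn1 -(@cnt_pred1 n m) //.
    apply: geq_cntD => c cn /=; have := agr c.
    by case: (eqVneq c m) => [->|]; lia.
  by move: bpm; case: (b m); case: (ltnP (p m) m) => //; lia.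
have conj_agr l : m < l -> forall c, c < m -> b c = (conj_swap m l p c < c).
  move=> ml c cm; rewrite agr // /conj_swap /swap.
  have -> : (c == m) = false by lia.
  have -> : (c == l) = false by lia.
  by do ?case: ifP => ?; lia.
case: (eqVneq (p m) m) => [pmm|npm].
  have exl : exists l, (m < l < n) && (p l < m).
    by have [l ? ?] := exists_arc_over pp H mn bm pmm tot; exists l; lia.
  (* By minimality of l, no arc over m ends before l, as [arcs_slack_across] requires for j <= l. *)
  have := ex_minnP exl; move=> [l /andP[mln plm] minl].
  have mv : raising p m l by left; split; [left|right].
  apply: (QS _ m l) => //; apply: (IH _ m) => //; try lia.
  - by apply: link_pattern_conj => //; lia.
  - apply: dominated_conj => // i k j ikj jn g.
    apply: (@arcs_slack_across p m (p l)) => //; try lia.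
      by rewrite (proj1 pp); lia.
    move=> c cj pc.
    have := minl c; have : p c <> m by move=> e; have := proj1 pp c; rewrite e pmm; lia.
    case: (eqVneq c m) => [e|cm]; first by move: pc; rewrite e pmm ltnn.
    lia.
  - by rewrite arcs_conj_total.
  - by apply: conj_agr; lia.
  have cE : conj_swap m l p m = p l by rewrite /conj_swap /swap eqxx; do ?case: ifP => ?; lia.
  by move: meas; rewrite /key cE pmm ltnn eqxx; do ?case: ifP => ?; lia.
have mpm : m < p m by lia.
(* For m < l < p m this is [raising p m l]. The positions before the least such l satisfy the
   hypothesis of [arcs_slack_nested], and [nested_block_absurd] shows that one exists. *)
pose good l := [|| p l == l, p l < m | p m < p l].
have exl : exists l, (m < l < p m) && good l.
  case: (boolP (has (fun l => (m < l < p m) && good l) (iota 0 n))) => [/hasP[l _ ?]|/hasPn no].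
    by exists l.
  case: (@nested_block_absurd p m) => // c cm.
  have := no c; rewrite mem_iota /good.
  have := proj2 pp m; have : p c <> m by move=> e; have := proj1 pp c; rewrite e; lia.
  have : p c <> p m by move=> e; have := proj1 pp c; have := proj1 pp m; rewrite e; lia.
  lia.
have := ex_minnP exl; move=> [l /andP[mlp gl] minl].
have pmn := proj2 pp m mn.
have nest c : m < c < l -> c < p c < p m \/ m < p c < c.
  move=> cl; have := minl c; rewrite /good.
  have : p c <> m by move=> e; have := proj1 pp c; rewrite e; lia.
  have : p c <> p m by move=> e; have := proj1 pp c; have := proj1 pp m; rewrite e; lia.
  lia.
have mln : m < l < n by lia.
have mv : raising p m l.
  case/or3P: gl => gl; [left; split; [right|left; apply/eqP]|left; split; right|right]; lia.
apply: (QS _ m l) => //; apply: (IH _ m) => //; try lia.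
- by apply: link_pattern_conj => //; lia.
- apply: dominated_conj => // i k j ikj jn /orP[|] g.
    apply: (@arcs_slack_across p m (p l)) => //; try lia.
      by rewrite (proj1 pp); lia.
    move=> c cj pc.
    case: (eqVneq c m) => [e|cm]; first by move: pc; rewrite e; lia.
    by have := nest c; lia.
  by apply: (@arcs_slack_nested p m l) => //; lia.
- by rewrite arcs_conj_total.
- by apply: conj_agr; lia.
have plm : p l <> m by move=> e; have := proj1 pp l; rewrite e; lia.
have cE : conj_swap m l p m = if p l == l then m else p l.
  by rewrite /conj_swap /swap eqxx; do ?case: ifP => ?; lia.
move: meas; rewrite /key cE mpm.
case: (eqVneq (p l) l) => [e|npl]; first by rewrite ltnn eqxx; lia.
by case: (ltnP m (p l)) gl => [g|g]; rewrite /good; case: eqP => ? ?; lia.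
Qed.

End Descent.

(** * Tableaux *)

Lemma cntE n (P : pred nat) : cnt n P = count P (iota 0 n).
Proof.
rewrite /cnt /index_iota subn0 -sum1_count [RHS]big_mkcond.
by apply: eq_bigr => c _; case: (P c).
Qed.

Lemma cnt_widen n i (P : pred nat) : i <= n -> cnt n (fun c => (c < i) && P c) = cnt i P.
Proof.
move=> ni; rewrite !cntE -(subnKC ni) iotaD count_cat [X in _ + X](_ : _ = 0) ?addn0.
  by apply: eq_in_count => c; rewrite mem_iota => ci; rewrite (_ : c < i) //; lia.
by apply/eqP; rewrite -leqn0 leqNgt -has_count; apply/hasPn => c; rewrite mem_iota; lia.
Qed.

Lemma cnt_mem n (s : seq nat) (P : pred nat) : uniq s -> {subset s <= iota 1 n} ->
  cnt n (fun c => P c.+1 && (c.+1 \in s)) = count P s.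
Proof.
move=> us sn; rewrite cntE.
transitivity (count P (filter (mem s) (iota 1 n))).
  rewrite count_filter (iotaDl 1 0) count_map; apply: eq_count => c /=.
  by rewrite add1n.
apply/seq.permP/uniq_perm; rewrite ?filter_uniq ?iota_uniq // => v.
by rewrite mem_filter /=; case: (boolP (v \in s)) => // /sn.
Qed.

Lemma count_incr_le f i r : (forall p q, p < q < r -> f p < f q) ->
  forall p, p < r -> (f p <= i) = (p < count (fun p => f p <= i) (iota 0 r)).
Proof.
elim: r => // r IH incr p pr; have -> : iota 0 r.+1 = iota 0 r ++ [:: r] by rewrite -addn1 iotaD.
rewrite count_cat /= addn0.
case: (leqP (f r) i) => fr; last first.
  rewrite addn0; case: (eqVneq p r) => [->|npr]; last first.
    by rewrite IH //; [move=> x y ?; apply: incr; lia|lia].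
  by have := count_size (fun p => f p <= i) (iota 0 r); rewrite size_iota; lia.
have -> : count (fun p => f p <= i) (iota 0 r) = r.
  rewrite -[RHS](size_iota 0); apply/eqP; rewrite -all_count; apply/allP => q.
  by rewrite mem_iota => qr; have := incr q r; lia.
by case: (eqVneq p r) => [->|npr]; [lia|have := incr p r; lia].
Qed.

Section Rows.
Variables (r s : nat) (T : seq (seq nat)).
Hypotheses (sr : s <= r) (shT : shape T = two_columns r s).

Lemma size_two_columns : size (two_columns r s) = r.
Proof. by rewrite size_cat !size_nseq subnKC. Qed.

Lemma nth_two_columns p : nth 0 (two_columns r s) p = (p < r) + (p < s).
Proof. by rewrite nth_cat size_nseq !nth_nseq; do ?case: ifP => ?; lia. Qed.

Lemma sumn_two_columns : sumn (two_columns r s) = r + s.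
Proof. by rewrite sumn_cat !sumn_nseq; lia. Qed.

Lemma rowsE : T = mkseq (fun p => [:: entry T p 0; entry T p 1]) s ++
                  map (fun p => [:: entry T p 0]) (iota s (r - s)).
Proof.
have szT : size T = r by rewrite -size_two_columns -shT size_map.
have szr p : size (nth [::] T p) = (p < r) + (p < s).
  rewrite -nth_two_columns -shT; case: (ltnP p (size T)) => pT; first by rewrite (nth_map [::]).
  by rewrite !nth_default ?size_map.
apply: (@eq_from_nth _ [::]) => [|p pT].
  by rewrite szT size_cat size_mkseq size_map size_iota subnKC.
have := szr p; rewrite nth_cat size_mkseq /entry.
case: (ltnP p s) => ps.
  by rewrite nth_mkseq //; case: (nth [::] T p) => [|x [|y [|z t]]] //=; lia.
rewrite (nth_map 0) ?size_iota; last by lia.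
rewrite nth_iota; last by lia.
by rewrite subnKC //; case: (nth [::] T p) => [|x [|y t]] //= ; lia.
Qed.

Lemma column0E : column T 0 = mkseq (fun p => entry T p 0) r.
Proof.
rewrite /column (all_filterP _); last by rewrite rowsE all_cat !all_map !all_predT.
rewrite {1}rowsE map_cat -!map_comp.
by rewrite -[in RHS](subnKC sr) /mkseq iotaD map_cat.
Qed.

Lemma column1E : column T 1 = mkseq (fun p => entry T p 1) s.
Proof.
have f2 t : [seq row <- [seq [:: entry T p 0; entry T p 1] | p <- t] | 1 < size row] =
    [seq [:: entry T p 0; entry T p 1] | p <- t] by elim: t => //= x t ->.
have f1 t : [seq row <- [seq [:: entry T p 0] | p <- t] | 1 < size row] = [::] by elim: t.
by rewrite /column {1}rowsE filter_cat f2 f1 cats0 -map_comp.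
Qed.

Lemma perm_columns : perm_eq (flatten T) (column T 0 ++ column T 1).
Proof.
rewrite column0E column1E {1}rowsE flatten_cat -[in mkseq _ r](subnKC sr).
rewrite /mkseq iotaD map_cat -catA.
have zipP (f g : nat -> nat) t :
    perm_eq (flatten [seq [:: f p; g p] | p <- t]) (map f t ++ map g t).
  elim: t => //= x t IH; rewrite perm_cons -[g x :: map g t]cat1s.
  by rewrite perm_sym perm_catCA /= perm_cons perm_sym.
rewrite (flatten_map1 (fun p => entry T p 0)) add0n.
pose f q p := entry T p q.
apply: (@perm_trans _ ((map (f 0) (iota 0 s) ++ map (f 1) (iota 0 s)) ++
                       map (f 0) (iota s (r - s)))).
  by rewrite perm_cat2r zipP.
by rewrite -catA perm_cat2l perm_catC.
Qed.

End Rows.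

(** * The link pattern of a row-standard tableau *)

Section RowStandard.
Variables (r s : nat) (T : seq (seq nat)).
Hypotheses (sr : s <= r) (hT : row_standard (two_columns r s) T).
Let n := r + s.

Local Notation a := (column T 0).
Local Notation b := (column T 1).

Let shT : shape T = two_columns r s. Proof. by case: hT. Qed.

Lemma perm_entries : perm_eq (a ++ b) (iota 1 n).
Proof.
rewrite -(permPl (perm_columns sr shT)).
by case: hT => _ + _; rewrite sumn_two_columns.
Qed.

Lemma uniq_entries : uniq (a ++ b).
Proof. by rewrite (perm_uniq perm_entries) iota_uniq. Qed.

Lemma uniq_col0 : uniq a. Proof. by have := uniq_entries; rewrite cat_uniq => /and3P[]. Qed.
Lemma uniq_col1 : uniq b. Proof. by have := uniq_entries; rewrite cat_uniq => /and3P[]. Qed.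

Lemma col_disj v : v \in a -> v \notin b.
Proof.
move=> va; have := uniq_entries; rewrite cat_uniq => /and3P[_ /hasPn h _].
by apply/negP => /h; rewrite va.
Qed.

Lemma mem_entries v : (v \in a) || (v \in b) = (0 < v <= n).
Proof. by rewrite -mem_cat (perm_mem perm_entries) mem_iota; lia. Qed.

Lemma col0_sub : {subset a <= iota 1 n}.
Proof. by move=> v va; rewrite -(perm_mem perm_entries) mem_cat va. Qed.
Lemma col1_sub : {subset b <= iota 1 n}.
Proof. by move=> v va; rewrite -(perm_mem perm_entries) mem_cat va orbT. Qed.

Lemma size_col0 : size a = r. Proof. by rewrite (column0E sr shT) size_mkseq. Qed.
Lemma size_col1 : size b = s. Proof. by rewrite (column1E sr shT) size_mkseq. Qed.
Lemma nth_col0 p : p < r -> nth 0 a p = entry T p 0.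
Proof. by move=> pr; rewrite (column0E sr shT) nth_mkseq. Qed.
Lemma nth_col1 p : p < s -> nth 0 b p = entry T p 1.
Proof. by move=> pr; rewrite (column1E sr shT) nth_mkseq. Qed.

Lemma lt_row p : p < s -> entry T p 0 < entry T p 1.
Proof. by move=> ps; case: hT => _ _; apply; rewrite nth_two_columns //; lia. Qed.

Lemma mem_col0 v : v \notin b -> 0 < v <= n -> v \in a.
Proof. by move=> vb; rewrite -mem_entries (negbTE vb) orbF. Qed.

(* The entry v occupies the position v - 1. *)
Definition second (c : nat) : bool := c.+1 \in b.

Lemma nb_second_count i j : nb_second n second i j = count (fun v => i < v <= j) b.
Proof. by rewrite -(cnt_mem _ uniq_col1 col1_sub); apply: eq_cnt => c _; rewrite ltnS. Qed.

Lemma nb_first_count i j : nb_first n second i j = count (fun v => i < v <= j) a.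
Proof.
rewrite -(cnt_mem _ uniq_col0 col0_sub); apply: eq_cnt => c cn.
rewrite ltnS /second; congr (_ && _); apply/idP/idP => [cb|/col_disj //].
by apply: mem_col0.
Qed.

(** The two positions of a row are exchanged. An entry absent from the first column has index r >= s
    there, so that positions outside [0, n), like rows with one box, are fixed. *)
Definition partner (c : nat) : nat :=
  if c.+1 \in b then (nth 0 a (index c.+1 b)).-1 else
  if index c.+1 a < s then (nth 0 b (index c.+1 a)).-1 else c.

Lemma col0_gt0 p : p < r -> 0 < nth 0 a p <= n.
Proof. by move=> pr; rewrite -mem_entries mem_nth ?size_col0. Qed.
Lemma col1_gt0 p : p < s -> 0 < nth 0 b p <= n.
Proof. by move=> pr; rewrite -mem_entries mem_nth ?size_col1 ?orbT. Qed.

Lemma partner_col1 p : p < s -> partner (nth 0 b p).-1 = (nth 0 a p).-1.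
Proof.
move=> ps; rewrite /partner prednK; last by have := col1_gt0 ps; lia.
by rewrite mem_nth ?size_col1 // index_uniq ?size_col1 ?uniq_col1.
Qed.

Lemma partner_col0 p : p < s -> partner (nth 0 a p).-1 = (nth 0 b p).-1.
Proof.
move=> ps; have pr : p < r by lia.
rewrite /partner prednK; last by have := col0_gt0 pr; lia.
rewrite (negbTE (col_disj _)) ?mem_nth ?size_col0 //.
by rewrite index_uniq ?size_col0 ?uniq_col0 // ps.
Qed.

Lemma partner_cases c : 
  [\/ exists2 p, p < s & c = (nth 0 b p).-1, exists2 p, p < s & c = (nth 0 a p).-1 | partner c = c].
Proof.
case: (boolP (c.+1 \in b)) => cb.
  constructor 1; exists (index c.+1 b); first by rewrite -size_col1 index_mem.
  by rewrite nth_index.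
case: (ltnP (index c.+1 a) s) => ca; last by constructor 3; rewrite /partner (negbTE cb) ltnNge ca.
constructor 2; exists (index c.+1 a) => //; rewrite nth_index // -index_mem size_col0; lia.
Qed.

Lemma partner_pattern : link_pattern n partner.
Proof.
split=> [c|c cn].
  case: (partner_cases c) => [[p ps ->]|[p ps ->]|pc]; last by rewrite !pc.
    by rewrite partner_col1 // partner_col0.
  by rewrite partner_col0 // partner_col1.
case: (partner_cases c) => [[p ps ->]|[p ps ->]|->//].
  by rewrite partner_col1 //; have := @col0_gt0 p; lia.
by rewrite partner_col0 //; have := @col1_gt0 p; lia.
Qed.

(** The increase along the rows orients each arc from the first column to the second. *)
Lemma partner_lt c : (partner c < c) = second c.
Proof.
rewrite /second; case: (partner_cases c) => [[p ps ->]|[p ps ->]|pc].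
- have := lt_row ps; rewrite -nth_col1 // -nth_col0; last lia.
  rewrite partner_col1 // (@prednK (nth 0 b p)); last by have := @col1_gt0 p; lia.
  by rewrite mem_nth ?size_col1 //; have := @col0_gt0 p; lia.
- have := lt_row ps; rewrite -nth_col1 // -nth_col0; last lia.
  rewrite partner_col0 // (@prednK (nth 0 a p)); last by have := @col0_gt0 p; lia.
  rewrite (negbTE (col_disj _)) ?mem_nth ?size_col0; [|lia|lia].
  by have := @col0_gt0 p; lia.
rewrite pc ltnn; apply/esym/negP => cb.
have ps : index c.+1 b < s by rewrite -size_col1 index_mem.
have := lt_row ps; rewrite -nth_col1 // -nth_col0 ?nth_index //; last lia.
have := partner_col1 ps; rewrite nth_index //= pc => e.
by have := @col0_gt0 (index c.+1 b); lia.
Qed.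

Lemma s_rowstd_arcs i j : s_rowstd T i j = arcs n partner i j.
Proof.
have -> : arcs n partner i j = count (fun v => (i <= partner v.-1) && (v <= j)) b.
  rewrite -(cnt_mem _ uniq_col1 col1_sub); apply: eq_cnt => c cn.
  by rewrite partner_lt /second /=; case: (_ \in b); rewrite ?andbT ?andbF //= andbF.
rewrite /s_rowstd [in RHS](column1E sr shT) count_map size_col1.
apply: eq_in_count => p; rewrite mem_iota => /= ps.
have pr : p < r by lia.
rewrite -nth_col1 // partner_col1 //.
have := lt_row ps; rewrite -nth_col1 // -nth_col0 //; have := col0_gt0 pr; lia.
Qed.

Lemma arcs_total : arcs n partner 0 n = nb_second n second 0 n.
Proof.
by apply: eq_cnt => c cn; rewrite partner_lt /=; lia.
Qed.

End RowStandard.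

Lemma bigmaxP (t : seq nat) (P : pred nat) : has P t ->
  [/\ \max_(x <- t | P x) x \in t, P (\max_(x <- t | P x) x) &
      forall v, v \in t -> P v -> v <= \max_(x <- t | P x) x].
Proof.
move=> hasP; suff [mt Pm] : \max_(x <- t | P x) x \in t /\ P (\max_(x <- t | P x) x).
  by split=> // v vt Pv; apply: (@leq_bigmax_seq _ t P id v).
elim: t hasP => //= x t IH; rewrite big_cons.
case: (boolP (P x)) => Px /= => [_|/IH[mt Pm]]; last by rewrite inE mt orbT.
case: (boolP (has P t)) => [/IH[mt Pm]|/hasPn Pt].
  by rewrite /maxn; case: ifP; rewrite !inE ?mt ?eqxx ?orbT.
by rewrite big1_seq ?maxn0 ?inE ?eqxx // => y /andP[Py /Pt]; rewrite Py.
Qed.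

Lemma size_reorder a b m : size (reorder a b m) = m.
Proof. by elim: m => //= m IH; rewrite size_rcons IH. Qed.

Lemma take_reorder a b p m : p <= m -> take p (reorder a b m) = reorder a b p.
Proof.
elim: m => [|m IH]; first by rewrite leqn0 => /eqP ->.
case: (eqVneq p m.+1) => [->|npm pm]; first by rewrite take_oversize ?size_reorder.
by rewrite -IH; [rewrite /= -cats1 takel_cat // size_reorder; lia|lia].
Qed.

Lemma nth_reorder a b p m : p < m -> nth 0 (reorder a b m) p =
  if p == 0 then (nth 0 b 0).-1
  else let rest := [seq x <- a | x \notin reorder a b p] in
       if p < size b then \max_(x <- rest | x < nth 0 b p) x else head 0 (sort leq rest).
Proof.
move=> pm; rewrite -(@nth_take p.+1) // take_reorder //=.
by rewrite nth_rcons size_reorder ltnn eqxx.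
Qed.

(** * The greedy reordering and the min formula for s^T *)

Section Standard.
Variables (r s : nat) (T : seq (seq nat)).
Hypotheses (s_gt0 : 0 < s) (sr : s <= r) (hT : standard (two_columns r s) T).
Let n := r + s.

Local Notation a := (column T 0).
Local Notation b := (column T 1).

Let rowT : row_standard (two_columns r s) T. Proof. by case: hT. Qed.
Let shT : shape T = two_columns r s. Proof. by case: rowT. Qed.

Lemma col_incr q p p' : p < p' -> p' < (if q == 0 then r else s) -> q < 2 ->
  entry T p q < entry T p' q.
Proof.
move=> pp' p'q q2; case: hT => _ inc; elim: p' pp' p'q => // p' IH pp' p'q.
have h : entry T p' q < entry T p'.+1 q.
  by apply: inc; rewrite nth_two_columns //; case: (eqVneq q 0) p'q; lia.
case: (eqVneq p p') => [->//|npp']; apply: ltn_trans h; apply: IH; first lia.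
exact: ltnW.
Qed.

Local Notation alpha i := (count (fun v => v <= i) a).
Local Notation beta i := (count (fun v => v <= i) b).

Lemma count_col0 i : alpha i = count (fun p => entry T p 0 <= i) (iota 0 r).
Proof. by rewrite (column0E sr shT) count_map. Qed.

Lemma count_col1 i : beta i = count (fun p => entry T p 1 <= i) (iota 0 s).
Proof. by rewrite (column1E sr shT) count_map. Qed.

Lemma col0_le i p : p < r -> (entry T p 0 <= i) = (p < alpha i).
Proof.
move=> pr; rewrite count_col0; apply: count_incr_le pr => x y xy.
by apply: col_incr => /=; lia.
Qed.

Lemma col1_le i p : p < s -> (entry T p 1 <= i) = (p < beta i).
Proof.
move=> pr; rewrite count_col1; apply: count_incr_le pr => x y xy.
by apply: col_incr => /=; lia.
Qed.

Lemma alpha_le i : alpha i <= r. Proof. by rewrite -(size_col0 sr rowT) count_size. Qed.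
Lemma beta_le i : beta i <= s. Proof. by rewrite -(size_col1 sr rowT) count_size. Qed.

(** Otherwise the row of index [alpha i] would have its second entry at most i and its first entry
    above i. *)
Lemma beta_alpha i : beta i <= alpha i.
Proof.
rewrite leqNgt; apply/negP => lt_ab; have := beta_le i => bs.
have xs : alpha i < s by lia.
have := lt_row sr rowT xs.
have : entry T (alpha i) 1 <= i by rewrite col1_le.
have : ~~ (entry T (alpha i) 0 <= i) by rewrite col0_le ?ltnn // (leq_trans xs sr).
move: (entry _ _ 0) (entry _ _ 1) => x y; lia.
Qed.

Lemma alphaE i : i <= n -> alpha i = i - nb_second n (second T) 0 i.
Proof.
move=> ni; have := @nb_first_second n (second T) 0 i ni; rewrite (nb_first_count sr rowT).
rewrite (@eq_in_count _ _ (fun v => v <= i)) => [|v va].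
  by move: (count _ a) (nb_second _ _ _ _) => x y; lia.
by have := mem_entries sr rowT v; rewrite va /=; lia.
Qed.

Lemma betaE i : beta i = nb_second n (second T) 0 i.
Proof.
rewrite (nb_second_count sr rowT); apply: eq_in_count => v vb.
by have := mem_entries sr rowT v; rewrite vb orbT; lia.
Qed.

Lemma subshape_two_columns i : i <= n ->
  subshape T i = two_columns (i - nb_second n (second T) 0 i) (nb_second n (second T) 0 i).
Proof.
move=> ni; rewrite -alphaE // -betaE.
set A := alpha i; set B := beta i.
have -> : subshape T i = [seq l <- [seq (p < A) + (p < B) | p <- iota 0 r] | 0 < l].
  rewrite /subshape; congr filter; rewrite {1}(rowsE sr shT) map_cat -!map_comp.
  rewrite -[in iota 0 r](subnKC sr) iotaD map_cat; congr (_ ++ _).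
    apply/eq_in_map => p; rewrite mem_iota => ps /=.
    by rewrite col0_le ?col1_le ?addn0 //; lia.
  apply/eq_in_map => p; rewrite mem_iota => ps /=.
  by rewrite col0_le //; have := beta_le i; rewrite -/B; lia.
have BA : B <= A := beta_alpha i; have Ar : A <= r := alpha_le i.
have constP (f : nat -> nat) k t : {in t, forall x, f x = k} -> map f t = nseq (size t) k.
  by elim: t => //= x t IH h; rewrite h ?mem_head // IH // => y yt; apply: h; rewrite inE yt orbT.
rewrite -(subnKC Ar) -[in iota 0 _](subnKC BA) !iotaD !map_cat !add0n.
rewrite (constP _ 2) => [|p]; last by rewrite mem_iota; lia.
rewrite (constP _ 1) => [|p]; last by rewrite mem_iota; lia.
rewrite (constP _ 0) => [|p]; last by rewrite mem_iota; lia.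
by rewrite !size_iota !filter_cat !filter_nseq /= !mul1n ?mul0n ?cats0.
Qed.

Local Notation A := (nth 0 (reorder a b (size a))).

(** The greedy choice is always possible: a_0, ..., a_p are p + 1 entries below b_p, and only p
    entries are used. For p = 0, b_0 - 1 is positive and lies in the first column, because b_0
    exceeds a_0 and is the least entry of the second. *)
Lemma reorder_spec p : p < s ->
  [/\ A p \in a, A p \notin reorder a b p, A p < nth 0 b p &
      forall v, v \in a -> v \notin reorder a b p -> v < nth 0 b p -> v <= A p].
Proof.
move=> ps; have pr : p < r by lia.
have ab q : q < s -> nth 0 a q < nth 0 b q.
  by move=> qs; rewrite (nth_col0 sr rowT) ?(nth_col1 sr rowT) ?(lt_row sr rowT) //; lia.
rewrite nth_reorder ?(size_col0 sr rowT) //.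
case: (eqVneq p 0) => [->|p0].
  have := ab 0 s_gt0; have a0 := col0_gt0 sr rowT (leq_trans s_gt0 sr).
  move=> ab0; split=> //; try lia.
  apply: (mem_col0 sr rowT); last by have := col1_gt0 sr rowT s_gt0; lia.
  apply/negP => /(nthP 0)[q]; rewrite (size_col1 sr rowT) => qs.
  rewrite !(nth_col1 sr rowT) //.
  case: (eqVneq q 0) => [->|q0]; first by rewrite -(nth_col1 sr rowT) //; lia.
  by have := @col_incr 1 0 q => /=; lia.
rewrite /= (size_col1 sr rowT) ps; set rest := [seq x <- a | _].
have [|mrest ltm maxm] := @bigmaxP rest (fun x => x < nth 0 b p).
  apply/hasP; have : ~~ all (mem (reorder a b p)) (mkseq (nth 0 a) p.+1).
    apply/negP => /allP sub.
    have := @uniq_leq_size _ (mkseq (nth 0 a) p.+1) (reorder a b p).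
    rewrite size_mkseq size_reorder ltnn => h; apply/notF/h => //.
    apply/mkseq_uniqP => x y; rewrite !inE => xp yp /eqP.
    by rewrite nth_uniq ?(uniq_col0 sr rowT) ?(size_col0 sr rowT) //; [move/eqP|lia|lia].
  rewrite -has_predC => /hasP[_ /mapP[q + ->] /= nq]; rewrite mem_iota => qp.
  exists (nth 0 a q).
    by rewrite mem_filter nq mem_nth // (size_col0 sr rowT); lia.
  apply: leq_ltn_trans (ab p ps); rewrite !(nth_col0 sr rowT) //; try lia.
  by case: (eqVneq q p) => [->//|qnp]; apply/ltnW/col_incr => /=; lia.
move: mrest; rewrite mem_filter => /andP[mp ma]; split=> // v va vp.
by apply: maxm; rewrite mem_filter vp.
Qed.

Lemma mem_reorder p v : p <= size a -> 
  reflect (exists2 q, q < p & v = A q) (v \in reorder a b p).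
Proof.
move=> pa; rewrite -(take_reorder a b pa); apply: (iffP (nthP 0)).
  rewrite size_take size_reorder => -[q qp <-]; exists q; first by case: ifP qp; lia.
  by rewrite nth_take //; case: ifP qp; lia.
case=> q qp ->; exists q; last by rewrite nth_take.
by rewrite size_take size_reorder; case: ifP; lia.
Qed.

Lemma reorder_inj p q : p < s -> q < s -> A p = A q -> p = q.
Proof.
have sa : size a = r := size_col0 sr rowT.
wlog pq : p q / p < q.
  move=> H ps qs e; case: (ltngtP p q) => // h; first exact: H.
  by apply/esym/H.
move=> ps qs e; have [_ /negP[]] := reorder_spec qs.
by apply/mem_reorder; [lia|exists p].
Qed.

(** A pair inside (i, j] has its left end in (i, k] or its right end in (k, j], and distinct pairs
    have distinct ends. *)
Lemma s_std_le i k j : i <= k <= j ->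
  s_std T i j <= nb_first n (second T) i k + nb_second n (second T) k j.
Proof.
move=> ikj; rewrite (nb_first_count sr rowT) (nb_second_count sr rowT) /s_std (size_col1 sr rowT).
apply: (@leq_trans (count (fun p => i < A p <= k) (iota 0 s) +
                    count (fun p => k < nth 0 b p <= j) (iota 0 s))).
  rewrite -count_predUI; apply: leq_trans (leq_addr _ _).
  by apply: sub_count => p /=; lia.
apply: leq_add.
  rewrite -(count_map A (fun v => i < v <= k)) -!size_filter; apply: uniq_leq_size.
    apply: filter_uniq; apply/mkseq_uniqP => x y; rewrite !inE; exact: reorder_inj.
  move=> v; rewrite !mem_filter => /andP[-> /mapP[p]]; rewrite mem_iota => ps ->.
  by have [] := @reorder_spec p.
have bE : map (nth 0 b) (iota 0 s) = b.
  by rewrite -(size_col1 sr rowT) map_nth_iota0 // take_size.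
by rewrite -[X in _ <= count _ X]bE count_map.
Qed.

(** Take k = b_p for the last b_p in (i, j] matched with an entry at most i, or k = i if there is
    none. An entry of the first column in (i, k] must have been used before stage p, since the
    greedy choice would have preferred it; and each b_q in (k, j] is matched above i. *)
Lemma s_std_ge i j : i <= j -> exists2 k, i <= k <= j &
  nb_first n (second T) i k + nb_second n (second T) k j <= s_std T i j.
Proof.
move=> ij; have sb : size b = s := size_col1 sr rowT.
have sa : size a = r := size_col0 sr rowT.
have bE : map (nth 0 b) (iota 0 s) = b by rewrite -sb map_nth_iota0 // take_size.
have AP p : p < s -> 0 < A p < nth 0 b p.
  move=> /reorder_spec[Aa _ -> _]; have := mem_entries sr rowT (A p).
  by rewrite Aa => /esym/andP[->].
pose bad p := [&& p < s, i < nth 0 b p, nth 0 b p <= j & A p <= i].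
case: (boolP (has bad (iota 0 s))) => [/hasP[p0 _ bad0]|/hasPn nobad]; last first.
  exists i; first lia.
  rewrite (nb_first_count sr rowT) (nb_second_count sr rowT).
  rewrite (@eq_count _ _ pred0) => [|v /=]; last lia.
  rewrite count_pred0 add0n -[X in count _ X]bE count_map /s_std sb.
  rewrite -!cntE; apply: leq_cnt => p ps /=.
  have := nobad p; rewrite mem_iota /bad.
  by have := AP p; lia.
have bnd p : bad p -> p <= s by rewrite /bad; lia.
have [p bp maxp] := ex_maxnP (ex_intro _ p0 bad0) bnd.
have /and4P[ps ib bj Ai] := bp.
exists (nth 0 b p); first lia.
rewrite (nb_first_count sr rowT) (nb_second_count sr rowT) /s_std sb.
set k := nth 0 b p in ib bj *.
apply: (@leq_trans (count (fun q => [&& i < A q, A q <= k & nth 0 b q <= k]) (iota 0 s) +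
                    count (fun q => k < nth 0 b q <= j) (iota 0 s))); last first.
  rewrite -count_predUI [X in _ + X](@eq_count _ _ pred0) => [|q /=]; last lia.
  rewrite count_pred0 addn0; rewrite -!cntE; apply: leq_cnt => q qs /=.
  have := maxp q; rewrite /bad; have := AP q.
  case: (eqVneq q p) => [->|]; first by rewrite -/k; lia.
  move=> qp; have : k < nth 0 b q -> p < q.
    move=> kq; rewrite ltnNge; apply/negP => qp'.
    move: kq; rewrite /k !(nth_col1 sr rowT) //; try lia.
    by have := @col_incr 1 q p => /=; lia.
  lia.
apply: leq_add; last by rewrite -[X in count _ X]bE count_map.
rewrite -!size_filter -[X in _ <= X](size_map A); apply: uniq_leq_size.
  by rewrite filter_uniq // (uniq_col0 sr rowT).
move=> v; rewrite mem_filter => /andP[vk va].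
have [_ _ _ maxA] := reorder_spec ps.
have vp : v < nth 0 b p.
  have : v != nth 0 b p; last lia.
  by apply: contraTneq va => ->; apply/negP => /(col_disj sr rowT); rewrite mem_nth ?sb.
have vr : v \in reorder a b p.
  by apply: contraT => vr; have := maxA v va vr vp; lia.
have /mem_reorder [|q qp vE] := vr; first lia.
apply/mapP; exists q => //; rewrite mem_filter mem_iota /= -vE.
have : nth 0 b q < nth 0 b p by rewrite !(nth_col1 sr rowT) //; try apply: col_incr => /=; lia.
lia.
Qed.

End Standard.

Import Order.TTheory GRing.Theory Num.Theory.
Local Open Scope ring_scope.

(** * Pluecker coordinates and limits of flags *)

Section SpanFlags.
Variables (K : fieldType) (V : vectType K).
Implicit Types w x y : nat -> V.

Lemma free_mkseq_le w k n : (k <= n)%N -> free (mkseq w n) -> free (mkseq w k).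
Proof.
move=> kn; have -> : mkseq w n = mkseq w k ++ map w (iota k (n - k)).
  by rewrite /mkseq -map_cat -iotaD subnKC.
by move/catl_free.
Qed.

Lemma freeP_mkseq w k : free (mkseq w k) <->
  forall v : 'I_k -> K, \sum_(a < k) v a *: w a = 0 -> forall a, v a = 0.
Proof.
have nthE v : \sum_(a < k) v a *: ([tuple of mkseq w k])`_a = \sum_(a < k) v a *: w a.
  by apply: eq_bigr => a _; rewrite nth_mkseq.
split=> [/(@freeP _ _ _ ([tuple of mkseq w k])) fw v v0|fw].
  by apply: fw; rewrite nthE.
by apply/(@freeP _ _ _ ([tuple of mkseq w k])) => v; rewrite nthE; apply: fw.
Qed.

Lemma mem_span_mkseq w k a : (a < k)%N -> w a \in <<mkseq w k>>%VS.
Proof. by move=> ak; rewrite memv_span // map_f // mem_iota. Qed.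

Lemma sub_span_mkseq w k (U : {vspace V}) :
  (forall a, (a < k)%N -> w a \in U) -> (<<mkseq w k>> <= U)%VS.
Proof.
by move=> wU; apply/span_subvP => _ /mapP[a + ->]; rewrite mem_iota; apply: wU.
Qed.

Lemma span_mkseq_le w k n : (k <= n)%N -> (<<mkseq w k>> <= <<mkseq w n>>)%VS.
Proof. by move=> kn; apply: sub_span_mkseq => a ak; apply: mem_span_mkseq; lia. Qed.

Lemma dim_mkseq w k : free (mkseq w k) -> \dim <<mkseq w k>> = k.
Proof. by move=> /eqnP ->; rewrite size_mkseq. Qed.

Lemma free_mkseq_span x w n : free (mkseq x n) ->
  (<<mkseq x n>> <= <<mkseq w n>>)%VS -> free (mkseq w n).
Proof.
move=> /dim_mkseq dx /dimvS; rewrite dx => dw.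
by rewrite /free eqn_leq dim_span size_mkseq dw.
Qed.

Lemma eq_span_triangular w y n :
  (forall c, (c < n)%N -> y c \in <<mkseq w c.+1>>%VS) ->
  (forall c, (c < n)%N -> w c \in <<mkseq y c.+1>>%VS) ->
  forall i, (i <= n)%N -> <<mkseq w i>>%VS = <<mkseq y i>>%VS.
Proof.
have half x z : (forall c, (c < n)%N -> x c \in <<mkseq z c.+1>>%VS) ->
    forall i, (i <= n)%N -> (<<mkseq x i>> <= <<mkseq z i>>)%VS.
  move=> xz i ni; apply: sub_span_mkseq => a ai.
  by apply: (subvP (span_mkseq_le z ai)); apply: xz; lia.
by move=> yw wy i ni; apply/eqP; rewrite eqEsubv !half.
Qed.

Lemma det_coord_neq0 k (X : k.-tuple V) w : free (mkseq w k) ->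
  (forall a, (a < k)%N -> w a \in <<X>>%VS) ->
  \det (\matrix_(a < k, b < k) coord X b (w a)) != 0.
Proof.
move=> /freeP_mkseq fw wX; apply/det0P => -[v v0 vC]; case/eqP: v0.
apply/rowP => a; rewrite mxE; apply: (fw (v 0)) => {a}.
transitivity (\sum_(a < k) \sum_(b < k) (v 0 a * coord X b (w a)) *: X`_b).
  apply: eq_bigr => a _; rewrite [in LHS](coord_span (wX a (ltn_ord a))) scaler_sumr.
  by apply: eq_bigr => b _; rewrite scalerA.
rewrite exchange_big big1 // => b _; rewrite -scaler_suml.
move/rowP/(_ b): vC; rewrite !mxE => vC.
rewrite -[X in X *: _](_ : 0 = _) ?scale0r // -[LHS]vC.
by apply: eq_bigr => a _; rewrite mxE.
Qed.

End SpanFlags.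

Section Plucker.
Variables (K : fieldType) (V : vectType K) (n : nat) (e : n.-tuple V).
Implicit Types (w : nat -> V) (F : 'I_n.+1 -> {vspace V}).

(** Coordinates computed from the given vectors rather than from [vbasis]: these depend polynomially
    on w. *)
Definition minor w (I : {set 'I_n}) : K :=
  \det (\matrix_(a < #|I|, b < #|I|) coord e (enum_val b) (w a)).

Definition Fl w : 'I_n.+1 -> {vspace V} := fun i => <<mkseq w i>>%VS.

Lemma card_setI_ord (I : {set 'I_n}) : (#|I| < n.+1)%N.
Proof. by rewrite ltnS -[X in (_ <= X)%N]card_ord max_card. Qed.

(** The scalar is the determinant of the change of basis of the span of the first k vectors, common
    to all I of size k. *)
Lemma minor_plucker_dim w k : (k <= n)%N -> free (mkseq w n) ->
  exists2 c : K, c != 0 &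
    forall I : {set 'I_n}, #|I| = k -> minor w I = c * plucker e (Fl w) I.
Proof.
move=> kn fw; have fk := free_mkseq_le kn fw.
set U := <<mkseq w k>>%VS.
have sX : size (vbasis U) == k by rewrite size_tuple dim_mkseq.
pose X := Tuple sX.
have wX a : (a < k)%N -> w a \in <<X>>%VS.
  by move=> ak; rewrite (span_basis (vbasisP U)) mem_span_mkseq.
exists (\det (\matrix_(a < k, b < k) coord X b (w a))); first exact: det_coord_neq0.
move=> I eI; subst k; rewrite /minor /plucker -det_mulmx; congr (\det _).
apply/matrixP => a b; rewrite !mxE [in LHS](coord_span (wX a (ltn_ord a))) linear_sum.
apply: eq_bigr => d _; rewrite linearZ !mxE /= /Fl inordK ?card_setI_ord //.
Qed.

Lemma minor_plucker w : free (mkseq w n) ->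
  exists2 c : 'I_n.+1 -> K, (forall k, c k != 0) &
    forall I, minor w I = c (inord #|I|) * plucker e (Fl w) I.
Proof.
move=> fw.
have ex (k : 'I_n.+1) : exists c : K, c != 0 /\
    forall I : {set 'I_n}, #|I| = k -> minor w I = c * plucker e (Fl w) I.
  by have [c c0 cI] := @minor_plucker_dim w k (ltn_ord k : k <= n)%N fw; exists c.
have [c cP] := fin_all_exists ex; exists c => [k|I]; first exact: (cP k).1.
by apply: (cP (inord #|I|)).2; rewrite inordK ?card_setI_ord.
Qed.

Lemma multihomogeneous_scale (P : {mpoly K[#|{set 'I_n}|]}) : multihomogeneous P ->
  forall c : 'I_n.+1 -> K, (forall k, c k != 0) ->
  exists2 C : K, C != 0 & forall v,
    P.@[fun l => c (inord #|enum_val l : {set 'I_n}|) * v l] = C * P.@[v].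
Proof.
move=> [d dP] c c0; exists (\prod_(k < n.+1) c k ^+ d k).
  by apply/prodf_neq0 => k _; rewrite expf_neq0.
move=> v; rewrite !mevalE mulr_sumr; apply: eq_big_seq => m mP.
under [in LHS]eq_bigr => l _ do rewrite exprMn.
rewrite big_split /= mulrCA; congr (_ * (_ * _)).
rewrite (partition_big (fun l => inord #|enum_val l : {set 'I_n}| : 'I_n.+1) predT) //=.
apply: eq_bigr => k _; rewrite -(dP m mP k) -prodrXr.
under eq_bigr => l /eqP -> do [].
apply: eq_bigl => l; rewrite -val_eqE /= inordK ?card_setI_ord //.
Qed.

(** The scalars of [minor_plucker], one per block of variables, factor out of P by
    multihomogeneity. *)
Lemma meval_minor w (P : {mpoly K[#|{set 'I_n}|]}) : multihomogeneous P ->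
  free (mkseq w n) ->
  (P.@[fun l => minor w (enum_val l)] == 0) = (P.@[plucker_point e (Fl w)] == 0).
Proof.
move=> mP fw; have [c c0 cI] := minor_plucker fw.
have [C C0 CE] := multihomogeneous_scale mP c0.
rewrite (meval_eq _ (fun l => cI (enum_val l))) CE mulf_eq0 (negbTE C0) //.
Qed.

Lemma eq_plucker F G : F =1 G -> plucker_point e F =1 plucker_point e G.
Proof. by move=> FG l; rewrite /plucker_point /plucker FG. Qed.

End Plucker.

Section Curve.
Variables (K : numFieldType) (V : vectType K) (n : nat) (e : n.-tuple V).

(** In characteristic 0 the numbers 1, ..., [size q] are distinct roots, too many for a nonzero
    q. *)
Lemma poly_eq0_off0 (q : {poly K}) : (forall t, t != 0 -> q.[t] = 0) -> q = 0.
Proof.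
move=> q0; pose rs := mkseq (fun k => k.+1%:R : K) (size q).
apply: (@roots_geq_poly_eq0 _ _ rs); last by rewrite size_mkseq.
  by apply/allP => _ /mapP[k _ ->]; apply/eqP/q0; rewrite pnatr_eq0.
by rewrite map_inj_uniq ?iota_uniq // => k l /eqP; rewrite eqr_nat eqSS => /eqP.
Qed.

(** Evaluated at the minors of x + t z, P becomes a polynomial in t; vanishing for t != 0, it
    vanishes at t = 0. *)
Lemma meval_limit x z (P : {mpoly K[#|{set 'I_n}|]}) : multihomogeneous P ->
  free (mkseq x n) ->
  (forall t, t != 0 -> let w a := x a + t *: z a in
     free (mkseq w n) /\ P.@[plucker_point e (Fl w)] = 0) ->
  P.@[plucker_point e (Fl (n := n) x)] = 0.
Proof.
move=> mP fx curve.
pose mp (I : {set 'I_n}) : {poly K} := \det (\matrix_(a < #|I|, b < #|I|)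
  ((coord e (enum_val b) (x a))%:P + 'X * (coord e (enum_val b) (z a))%:P)).
have mpE t I : (mp I).[t] = minor e (fun a => x a + t *: z a) I.
  rewrite -horner_evalE -det_map_mx; congr (\det _).
  by apply/matrixP => a b; rewrite !mxE /= horner_evalE !hornerE linearD linearZ.
pose q := \sum_(m <- msupp P) (P@_m)%:P * \prod_l mp (enum_val l) ^+ m l.
have qE t : q.[t] = P.@[fun l => minor e (fun a => x a + t *: z a) (enum_val l)].
  rewrite mevalE horner_sum; apply: eq_bigr => m _.
  rewrite hornerM hornerC horner_prod; congr (_ * _).
  by apply: eq_bigr => l _; rewrite horner_exp mpE.
apply/eqP; rewrite -meval_minor //; apply/eqP.
transitivity q.[0].
  rewrite qE; apply: meval_eq => l; rewrite /minor; congr (\det _).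
  by apply/matrixP => a b; rewrite !mxE scale0r addr0.
suff -> : q = 0 by rewrite horner0.
apply: poly_eq0_off0 => t /curve[fw Pw]; apply/eqP.
by rewrite qE meval_minor // Pw.
Qed.

End Curve.

(** * Bases following a link pattern and their degenerations *)

Section LinkBases.
Variables (K : fieldType) (V : vectType K) (n : nat) (u : 'End(V)).

Definition link_basis (p : nat -> nat) (x : nat -> V) : Prop :=
  free (mkseq x n) /\
  forall c, (c < n)%N -> u (x c) = if (p c < c)%N then x (p c) else 0.

(* For t <> 0 the flag of x with x_m replaced by x_m + t x_l is spanned by this
   basis, which follows the conjugated pattern. *)
Definition moved (p : nat -> nat) (m l : nat) (x : nat -> V) (t : K) (c : nat) : V :=
  if c == m then x l + t^-1 *: x m else if c == l then x m else
  if (c == p l) && (l < p m < p l)%N then x c + t^-1 *: x (p m) else x c.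

Lemma moved_link_basis p m l x t : link_pattern n p -> (m < l < n)%N -> raising p m l ->
  link_basis p x -> forall c, (c < n)%N ->
  u (moved p m l x t c) =
    if (conj_swap m l p c < c)%N then moved p m l x t (conj_swap m l p c) else 0.
Proof.
move=> [pK pn] mln mv [_ ux] c cn.
have mv' := mv; rewrite /raising in mv'.
have [mn ln] : (m < n /\ l < n)%N by lia.
have e1 : (p c == m) = (c == p m) by rewrite (can2_eq pK pK).
have e2 : (p c == l) = (c == p l) by rewrite (can2_eq pK pK).
(* In every raising configuration m is fixed or opens an arc. *)
have uxm : u (x m) = 0.
  by rewrite ux // ifF //; lia.
have pml : p m <> l by lia.
have plm : p l <> m by move=> h; apply: pml; rewrite -h pK.
case: (eqVneq c m) => [->|cm].
  rewrite /conj_swap {2 3}/swap eqxx /swap {1}/moved eqxx.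
  rewrite linearD linearZ /= uxm scaler0 addr0 ux //.
  case: (eqVneq (p l) m) => // _; case: (eqVneq (p l) l) => [h|h].
    by rewrite h !ltnn.
  case: mv => [[_ []]|] mv; [lia|..|by rewrite !ifF //; lia].
  rewrite !ifT //; last lia.
  by rewrite /moved !ifF //; lia.
case: (eqVneq c l) => [->|cl].
  have lm : (l == m) = false by lia.
  rewrite /conj_swap {2 3}/swap lm eqxx {1}/moved lm eqxx uxm.
  by rewrite ifF // /swap; case: mv; do ?case: ifP => ?; lia.
have conjE : conj_swap m l p c = swap m l (p c).
  by rewrite /conj_swap {2}/swap (negbTE cm) (negbTE cl).
rewrite conjE /swap e1 e2 {1}/moved (negbTE cm) (negbTE cl).
case: (eqVneq c (p m)) => [cpm|cpm].
  have -> : (c == p l) = false by apply/eqP => h; have := pK m; rewrite -cpm h pK; lia.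
  rewrite /= ux // cpm pK !ifT; [|by lia..].
  by rewrite /moved ifF ?eqxx //; lia.
case: (eqVneq c (p l)) => [cpl|cpl] /=; last first.
  rewrite ux //; case: ifP => // pcc; rewrite /moved.
  have -> : (p c == m) = false by rewrite e1; apply/negbTE.
  have -> : (p c == l) = false by rewrite e2; apply/negbTE.
  by rewrite (can_eq pK) (negbTE cl).
rewrite [moved _ _ _ _ _ m]/moved eqxx.
(* When the arcs of m and l cross, the added term makes u send the vector at p l to x_l + t^-1 x_m,
   the new vector at m. Otherwise p l < m, the position p l opens an arc, and both sides are 0. *)
case: ifP => g.
  rewrite linearD linearZ /= !ux //; last by apply: pn.
  by rewrite cpl !pK !ifT //; lia.
rewrite ux // cpl pK !ifF //; lia.
Qed.

(** The change of basis is triangular: besides scaling at m, the position l involves m < l, and p l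
    involves p m only when p m < p l. *)
Lemma moved_link_basis_span p m l x t : link_pattern n p -> (m < l < n)%N -> raising p m l ->
  t != 0 -> let w a := x a + t *: (if a == m then x l else 0) in
  forall i, (i <= n)%N -> <<mkseq w i>>%VS = <<mkseq (moved p m l x t) i>>%VS.
Proof.
move=> [pK pn] mln mv t0 w; set y := moved p m l x t.
have wE a : a != m -> w a = x a by move=> am; rewrite /w (negbTE am) scaler0 addr0.
have yE a : a != m -> a != l -> (a != p l) || ~~ (l < p m < p l)%N -> y a = x a.
  move=> am al; rewrite -negb_and => /negbTE g.
  by rewrite /y /moved (negbTE am) (negbTE al) g.
have ym : y m = t^-1 *: w m.
  by rewrite /y /moved /w eqxx scalerDr scalerA mulVf // scale1r addrC.
have yl : y l = x m by rewrite /y /moved eqxx ifF //; lia.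
have wl : w l = x l by apply: wE; lia.
have lm : l != m by lia.
have wm : w m = t *: y m by rewrite ym scalerA mulfV // scale1r.
apply: eq_span_triangular => c cn.
  have [->|cm] := eqVneq c m; first by rewrite ym memvZ // mem_span_mkseq.
  have [->|cl] := eqVneq c l.
    have -> : y l = w m - t *: w l by rewrite yl wl /w eqxx addrK.
    by rewrite memvB ?memvZ // mem_span_mkseq //; lia.
  case: (boolP ((c == p l) && (l < p m < p l)%N)) => g; last first.
    by rewrite yE -?negb_and // -wE // mem_span_mkseq.
  rewrite /y /moved (negbTE cm) (negbTE cl) g -[x c]wE // -[x (p m)]wE; last lia.
  by rewrite memvD ?memvZ // mem_span_mkseq //; lia.
have [->|cm] := eqVneq c m; first by rewrite wm memvZ // mem_span_mkseq.
have [->|cl] := eqVneq c l.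
  have -> : w l = y m - t^-1 *: y l by rewrite yl wl /y /moved eqxx addrK.
  by rewrite memvB ?memvZ // mem_span_mkseq //; lia.
rewrite wE //.
case: (boolP ((c == p l) && (l < p m < p l)%N)) => g; last first.
  by rewrite -yE -?negb_and // mem_span_mkseq.
have -> : x c = y c - t^-1 *: y (p m).
  rewrite [y (p m)]yE ?(can_eq pK) //; try lia.
  by rewrite /y /moved (negbTE cm) (negbTE cl) g addrK.
by rewrite memvB ?memvZ // mem_span_mkseq //; lia.
Qed.

End LinkBases.

Lemma raising_limit (K : numFieldType) (V : vectType K) n (e : n.-tuple V) (u : 'End(V))
    (P : {mpoly K[#|{set 'I_n}|]}) p m l :
  multihomogeneous P -> link_pattern n p -> (m < l < n)%N -> raising p m l ->
  (forall x, link_basis n u (conj_swap m l p) x -> P.@[plucker_point e (Fl x)] = 0) ->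
  forall x, link_basis n u p x -> P.@[plucker_point e (Fl (n := n) x)] = 0.
Proof.
move=> mP pp mln mv Pconj x lx; have [fx _] := lx.
apply: (@meval_limit _ _ _ _ _ (fun a => if a == m then x l else 0)) => // t t0 w.
have wy := moved_link_basis_span x pp mln mv t0; rewrite -/w in wy.
have fw : free (mkseq w n).
  apply: (free_mkseq_span fx); apply: sub_span_mkseq => a an.
  have wE b : b != m -> w b = x b by move=> bm; rewrite /w (negbTE bm) scaler0 addr0.
  have [->|am] := eqVneq a m; last by rewrite -wE // mem_span_mkseq.
  have -> : x m = w m - t *: w l by rewrite [w l]wE ?/w ?eqxx ?addrK //; lia.
  by rewrite memvB ?memvZ // mem_span_mkseq //; lia.
split=> //; set y := moved p m l x t.
rewrite (@meval_eq _ _ _ (plucker_point e (Fl y))); last first.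
  by apply: eq_plucker => i; rewrite /Fl wy //; case: i.
apply: Pconj; split; last exact: moved_link_basis.
by apply: (free_mkseq_span fw); rewrite wy.
Qed.

Lemma sorted_two_columns r s : sorted geq (two_columns r s).
Proof.
rewrite sorted_pairwise; last by move=> x y z /= yx zy; apply: leq_trans zy yx.
have pw_nseq k x : pairwise geq (nseq k x) by elim: k => //= k ->; rewrite all_nseq /= leqnn orbT.
rewrite pairwise_cat !pw_nseq !andbT; apply/allrelP => x y.
by rewrite !mem_nseq => /andP[_ /eqP ->] /andP[_ /eqP ->].
Qed.

Lemma all_two_columns r s : all (fun l => 0 < l)%N (two_columns r s).
Proof. by rewrite all_cat !all_nseq !orbT. Qed.

(** * Jordan types and ranks along a flag *)

Section Strata.
Variables (K : fieldType) (V : vectType K) (u : 'End(V)).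

Lemma young_diagram_link n p x i : link_pattern n p -> link_basis n u p x -> (i <= n)%N ->
  let beta := cnt n (fun c => (c < i) && (p c < c))%N in
  young_diagram_of u <<mkseq x i>>%VS (two_columns (i - beta) beta).
Proof.
move=> pp [fx ux] ni beta; have [pK pn] := pp.
pose C := [seq c <- iota 0 i | (p c < c)%N].
pose D := [seq c <- iota 0 i | ~~ (p c < c)%N && ~~ (c < p c < i)%N].
have sC : size C = beta by rewrite size_filter -cntE -(cnt_widen _ ni).
have iE : (i = beta + beta + size D)%N.
  (* The positions below i close an arc, open an arc ending below i, or lie in [D]; p exchanges the
     first two kinds. *)
  rewrite size_filter -cntE -[LHS]subn0 -(@cnt_itv i 0 i) // -[in RHS](cnt_widen _ ni).
  have oE : beta = cnt n (fun c => (c < i) && (c < p c < i))%N.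
    rewrite /beta -(reindex_cnt _ pp); apply: eq_cnt => c cn /=; rewrite pK; lia.
  rewrite [X in (X + _ + _)%N]oE.
  rewrite -(cnt_widen _ ni).
  have <- : (cnt n (fun c => (c < i) && ((p c < c) || (c < p c < i))) =
    cnt n (fun c => (c < i) && (c < p c < i)) + beta)%N.
    by apply: eq_cntD => c cn /=; lia.
  by apply: eq_cntD => c cn /=; lia.
have b_le : (beta <= i - beta)%N by lia.
have memC q : (q < beta)%N -> (nth 0 C q < i)%N /\ (p (nth 0 C q) < nth 0 C q)%N.
  by rewrite -sC => /(mem_nth 0%N); rewrite mem_filter mem_iota add0n => /andP[-> /andP[_ ->]].
split; [exact: sorted_two_columns|exact: all_two_columns|].
exists (fun q k => if (q < beta)%N then
    (if k == 0%N then x (p (nth 0 C q)%N) else x (nth 0 C q)%N)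
  else x (nth 0 D (q - beta))%N); split; last first.
  move=> q k; rewrite size_two_columns // => qi; rewrite nth_two_columns // qi.
  case: (ltnP q beta) => qb.
    have [Ci Cq] := memC q qb.
    case: k => [|[|k]] //= _; last by rewrite ux ?Cq //; lia.
    by rewrite ux; [rewrite pK ifF //; lia|apply: pn; lia].
  case: k => // _.
  have qD : (q - beta < size D)%N by lia.
  have := mem_nth 0%N qD; rewrite mem_filter mem_iota => /andP[/andP[/negbTE qp _] /andP[_ qi']].
  by rewrite ux ?qp // (leq_trans qi').
rewrite basisEdim size_allpairs_dep; apply/andP; split; last first.
  rewrite dim_mkseq; last exact: free_mkseq_le fx.
  under eq_map => q do rewrite size_iota.
  by rewrite map_nth_iota0 // take_size sumn_two_columns //; lia.
apply: sub_span_mkseq => c ci; apply: memv_span.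
have cn : (c < n)%N by lia.
have memC' d : (d < i)%N -> (p d < d)%N -> (index d C < beta)%N /\ nth 0%N C (index d C) = d.
  by move=> di pd; rewrite -sC index_mem; split; [|apply: nth_index];
    rewrite mem_filter pd mem_iota; lia.
case: (ltnP (p c) c) => pc.
  have [ib nE] := memC' c ci pc.
  apply/allpairsPdep; exists (index c C), 1%N; rewrite !mem_iota size_two_columns //.
  by rewrite nth_two_columns // ib nE; split=> //; lia.
case: (boolP (c < p c < i)%N) => pc2.
  have pci : (p c < i)%N by lia.
  have ppc : (p (p c) < p c)%N by rewrite pK; lia.
  have [ib nE] := memC' _ pci ppc.
  apply/allpairsPdep; exists (index (p c) C), 0%N; rewrite !mem_iota size_two_columns //.
  by rewrite nth_two_columns // ib nE pK; split=> //; lia.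
have cD : c \in D by rewrite mem_filter pc2 mem_iota; lia.
have iD : (index c D < size D)%N by rewrite index_mem.
apply/allpairsPdep; exists (beta + index c D)%N, 0%N; rewrite !mem_iota size_two_columns //.
rewrite nth_two_columns // addKn nth_index //.
rewrite (_ : (beta + index c D < beta)%N = false); last lia.
by split=> //; lia.
Qed.

Lemma dim_limg_two_columns (W : {vspace V}) r s : (s <= r)%N ->
  young_diagram_of u W (two_columns r s) -> \dim (u @: W) = s.
Proof.
move=> sr [_ _ [x [bx ux]]].
have sizeY := size_two_columns sr; have nthY := nth_two_columns sr.
set X := (X in basis_of W X) in bx.
have WE : W = <<X>>%VS by rewrite (span_basis bx).
have dW : \dim W = (r + s)%N.
  have /andP[_ /eqnP dX] := bx; rewrite WE dX size_allpairs_dep.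
  under eq_map => q do rewrite size_iota.
  by rewrite map_nth_iota0 // take_size sumn_two_columns.
have memX q k : (q < r)%N -> (k < (q < r) + (q < s))%N -> x q k \in X.
  by move=> qr kq; apply/allpairsPdep; exists q, k; rewrite !mem_iota sizeY nthY.
have limgE : (u @: W = <<mkseq (fun q => x q 0%N) s>>)%VS.
  rewrite WE limg_span; apply/eqP; rewrite eqEsubv; apply/andP; split.
    apply/span_subvP => _ /mapP[_ /allpairsPdep[q [k [+ + ->]]] ->].
    rewrite !mem_iota sizeY nthY !add0n /= => qr kq; rewrite ux ?sizeY ?nthY //.
    case: k kq => [|k] kq; first exact: mem0v.
    have k0 : k = 0%N by lia.
    by rewrite k0; apply: (mem_span_mkseq (fun q => x q 0%N)); lia.
  apply: sub_span_mkseq => q qs; apply: memv_span; apply/mapP.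
  by exists (x q 1%N); [apply: memX; lia|rewrite ux ?sizeY ?nthY //; lia].
apply/eqP; rewrite eqn_leq; apply/andP; split.
  by rewrite limgE (leq_trans (dim_span _)) // size_mkseq.
(* The vectors x q 0 are free by counting: with the s vectors x q 1 they span W, of dimension r +
   s. *)
have kerW : (W <= <<mkseq (fun q => x q 0%N) r>> + <<mkseq (fun q => x q 1%N) s>>)%VS.
  rewrite WE; apply/span_subvP => _ /allpairsPdep[q [k [+ + ->]]].
  rewrite !mem_iota sizeY nthY !add0n /= => qr kq.
  case: k kq => [|k] kq.
    by apply: (subvP (addvSl _ _)); apply: (mem_span_mkseq (fun q => x q 0%N)); lia.
  have k0 : k = 0%N by lia.
  by rewrite k0; apply: (subvP (addvSr _ _)); apply: (mem_span_mkseq (fun q => x q 1%N)); lia.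
have free0 : free (mkseq (fun q => x q 0%N) r).
  rewrite /free eqn_leq dim_span size_mkseq /= -(leq_add2r s) -dW.
  apply: leq_trans (dimvS kerW) _; apply: leq_trans (dimv_add_leqif _ _) _.
  rewrite leq_add2l; apply: leq_trans (dim_span _) _; by rewrite size_mkseq.
by rewrite limgE dim_mkseq // (free_mkseq_le sr free0).
Qed.

End Strata.

Lemma link_basis_springer_fiber (K : fieldType) (V : vectType K) n (u : 'End(V)) p x :
  link_pattern n p -> link_basis n u p x -> springer_fiber u (Fl (n := n) x).
Proof.
move=> [pK pn] [fx ux]; split; [split=> [i|i j ij]|move=> i]; rewrite /Fl.
- by rewrite dim_mkseq // (free_mkseq_le _ fx) // -ltnS.
- exact: span_mkseq_le.
rewrite limg_span; apply/span_subvP => _ /mapP[_ /mapP[c + ->] ->].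
rewrite mem_iota add0n => /= ci.
have cn : (c < n)%N by rewrite -ltnS (leq_trans _ (ltn_ord i)).
rewrite ux //; case: ifP => pc; last exact: mem0v.
by apply: mem_span_mkseq; apply: ltn_trans ci.
Qed.

Lemma nb_second_total r s T : (s <= r)%N -> row_standard (two_columns r s) T ->
  nb_second (r + s) (second T) 0 (r + s) = s.
Proof.
move=> sr hT; rewrite (nb_second_count sr hT) -[RHS](size_col1 sr hT); apply/eqP.
rewrite -all_count; apply/allP => v vb; have := mem_entries sr hT v.
by rewrite vb orbT => <-.
Qed.

(** * The flag of a row-standard tableau *)

Section TableauFlag.
Variables (K : fieldType) (V : vectType K) (r s : nat) (u : 'End(V)).
Variables (e : (r + s).-tuple V) (T : seq (seq nat)).
Hypotheses (sr : (s <= r)%N) (he : jordan_basis r s u e).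
Hypothesis hT : row_standard (two_columns r s) T.
Let n := (r + s)%N.

(** The Jordan basis in the order of the entries of T, so that the flag of T is spanned by its
    initial segments. *)
Definition tableau_basis (c : nat) : V :=
  if c.+1 \in column T 1 then e`_(r + index c.+1 (column T 1)) else
  e`_(index c.+1 (column T 0)).

Lemma tableau_basis0 p : (p < r)%N -> tableau_basis (entry T p 0).-1 = e`_p.
Proof.
move=> pr; rewrite -(nth_col0 sr hT) // /tableau_basis prednK; last first.
  by have := col0_gt0 sr hT pr; lia.
rewrite (negbTE (col_disj sr hT _)) ?mem_nth ?(size_col0 sr hT) //.
by rewrite index_uniq ?(size_col0 sr hT) ?(uniq_col0 sr hT).
Qed.

Lemma tableau_basis1 p : (p < s)%N -> tableau_basis (entry T p 1).-1 = e`_(r + p).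
Proof.
move=> ps; rewrite -(nth_col1 sr hT) // /tableau_basis prednK; last first.
  by have := col1_gt0 sr hT ps; lia.
by rewrite mem_nth ?index_uniq ?(size_col1 sr hT) ?(uniq_col1 sr hT).
Qed.

Lemma free_tableau_basis : free (mkseq tableau_basis n).
Proof.
have [be _ _] := he.
have eE : mkseq (nth 0 e) n = e by have := mkseq_nth 0 e; rewrite size_tuple.
apply: (@free_mkseq_span _ _ (nth 0 e)); rewrite eE; first exact: basis_free be.
apply/span_subvP => _ /(nthP 0)[k + <-]; rewrite size_tuple => kn.
case: (ltnP k r) => kr.
  rewrite -tableau_basis0 // mem_span_mkseq // -(nth_col0 sr hT) //.
  by have := col0_gt0 sr hT kr; lia.
rewrite -(subnKC kr) -tableau_basis1; last lia.
have ks : (k - r < s)%N by lia.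
rewrite mem_span_mkseq // -(nth_col1 sr hT) //.
by have := col1_gt0 sr hT ks; lia.
Qed.

Lemma tableau_link_basis : link_basis n u (partner s T) tableau_basis.
Proof.
split=> [|c cn]; first exact: free_tableau_basis.
have [_ u0 u1] := he; rewrite (partner_lt sr hT) /second.
case: ifP => cb.
  have qs : (index c.+1 (column T 1) < s)%N by rewrite -(size_col1 sr hT) index_mem.
  rewrite {1}/tableau_basis cb u1 // -tableau_basis0; last lia.
  by rewrite -(nth_col0 sr hT) -?(partner_col1 sr hT) ?nth_index //; lia.
rewrite /tableau_basis cb u0 // -(size_col0 sr hT) index_mem.
by apply: (mem_col0 sr hT); rewrite ?cb.
Qed.

Lemma tableau_flagE : tableau_flag r s e T =1 Fl (n := n) tableau_basis.
Proof.
move=> i; rewrite /tableau_flag /Fl; apply/eqP; rewrite eqEsubv; apply/andP; split.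
  apply/span_subvP => w; rewrite mem_cat => /orP[] /mapP[p]; rewrite mem_filter mem_iota.
    move=> /andP[pi /= pr] ->; rewrite -tableau_basis0 // mem_span_mkseq //.
    by have := col0_gt0 sr hT pr; rewrite (nth_col0 sr hT) // => /andP[? _]; rewrite prednK.
  move=> /andP[pi /= ps] ->; rewrite -tableau_basis1 // mem_span_mkseq //.
  by have := col1_gt0 sr hT ps; rewrite (nth_col1 sr hT) // => /andP[? _]; rewrite prednK.
apply: sub_span_mkseq => c ci; apply: memv_span; rewrite mem_cat /tableau_basis.
have cn : (c < n)%N by rewrite -ltnS (leq_trans _ (ltn_ord i)).
case: ifP => cb; apply/orP; [right|left]; apply: map_f; rewrite mem_filter mem_iota /=.
  have qs : (index c.+1 (column T 1) < s)%N by rewrite -(size_col1 sr hT) index_mem.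
  by rewrite qs -(nth_col1 sr hT) // nth_index // ci.
have ca : c.+1 \in column T 0 by apply: (mem_col0 sr hT); rewrite ?cb.
have qr : (index c.+1 (column T 0) < r)%N by rewrite -(size_col0 sr hT) index_mem.
by rewrite qr -(nth_col0 sr hT) // nth_index // ci.
Qed.

End TableauFlag.

Lemma dominated_component (K : numFieldType) (V : vectType K) (r s : nat) (u : 'End(V))
    (e : (r + s).-tuple V) (T T' : seq (seq nat)) :
  (0 < s)%N -> (s <= r)%N -> jordan_basis r s u e ->
  standard (two_columns r s) T -> row_standard (two_columns r s) T' ->
  (forall i j : nat, (i < j)%N -> (j <= r + s)%N -> (s_rowstd T' i j <= s_std T i j)%N) ->
  springer_component e u T (tableau_flag r s e T').
Proof.
move=> s0 sr he hT hT' le_s; have [rowT _] := hT.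
have pp := partner_pattern sr hT'.
have lx := tableau_link_basis sr he hT'.
have FE := tableau_flagE e sr hT'.
have fib : springer_fiber u (tableau_flag r s e T').
  have [[dF mF] uF] := link_basis_springer_fiber pp lx.
  by split; [split=> [i|i j ij]|move=> i]; rewrite !FE; [exact: dF|exact: mF|exact: uF].
split=> //; split; first by case: fib.
move=> P mP Pvan; rewrite (meval_eq _ (eq_plucker e FE)).
(* The polynomial P is fixed before the descent, so each step is a limit for one equation and no
   closure of a closure is formed. *)
pose Q p := forall x, link_basis (r + s) u p x -> P.@[plucker_point e (Fl x)] = 0.
apply: (@descent (r + s) (second T) Q) lx => // [p ppat close x lpx|p m l ppat mln mv Qc||].
- apply: Pvan; split; first exact: link_basis_springer_fiber lpx.
  move=> i; have ni : (i <= r + s)%N by rewrite -ltnS.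
  rewrite (subshape_two_columns s0 sr hT) //.
  have -> : nb_second (r + s) (second T) 0 i = cnt (r + s) (fun c => (c < i) && (p c < c))%N.
    by apply: eq_cnt => c cn; rewrite close.
  exact: young_diagram_link.
- exact: (raising_limit mP ppat mln mv Qc).
- move=> i k j ikj jn; apply: leq_trans (s_std_le s0 sr hT ikj).
  rewrite -(s_rowstd_arcs sr hT'); case: (ltnP i j) => ij; first exact: le_s.
  by rewrite (s_rowstd_arcs sr hT') /arcs /cnt big1 // => c _; lia.
by rewrite (arcs_total sr hT') !nb_second_total.
Qed.

(** * Semicontinuity of the ranks *)

Section Multidegree.
Variables (K : fieldType) (n : nat).
Local Notation M := {mpoly K[#|{set 'I_n}|]}.

(** The degree is exposed because sums require equal degrees while products add them. *)
Definition of_multidegree (d : nat -> nat) (P : M) : Prop :=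
  forall m, m \in msupp P -> forall k,
    (\sum_(l < #|{set 'I_n}| | #|enum_val l : {set 'I_n}| == k) m l)%N = d k.

Lemma of_multidegreeZ d (c : K) (P : M) : of_multidegree d P -> of_multidegree d (c *: P).
Proof. by move=> dP m /msuppZ_le; apply: dP. Qed.

Lemma of_multidegree_sum d (I : Type) (t : seq I) (F : I -> M) :
  (forall i, of_multidegree d (F i)) -> of_multidegree d (\sum_(i <- t) F i).
Proof.
move=> dF; elim/big_rec: _ => [m|i P _ dP m]; first by rewrite msupp0.
by move=> /msuppD_le; rewrite mem_cat => /orP[/dF|/dP].
Qed.

Lemma of_multidegreeM d d' (P Q : M) : of_multidegree d P -> of_multidegree d' Q ->
  of_multidegree (fun k => d k + d' k)%N (P * Q).
Proof.
move=> dP dQ m /msuppM_le /allpairsP[[m1 m2] /= [/dP d1 /dQ d2 ->]] k.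
by rewrite -d1 -d2 -big_split; apply: eq_bigr => l _; rewrite mnmDE.
Qed.

Lemma of_multidegree_prod (I : Type) (t : seq I) (d : I -> nat -> nat) (F : I -> M) :
  (forall i, of_multidegree (d i) (F i)) ->
  of_multidegree (fun k => \sum_(i <- t) d i k)%N (\prod_(i <- t) F i).
Proof.
move=> dF; elim: t => [|i t IH].
  rewrite big_nil => m; rewrite msupp1 inE => /eqP -> k; rewrite big_nil.
  by rewrite big1 // => l _; rewrite mnm0E.
rewrite big_cons; have := of_multidegreeM (dF i) IH => h m mP k.
by rewrite h // big_cons.
Qed.

Lemma of_multidegreeX l :
  of_multidegree (fun k => #|enum_val l : {set 'I_n}| == k) ('X_l : M).
Proof.
move=> m; rewrite msuppX inE => /eqP -> k.
rewrite (eq_bigr (fun l' => (l == l') : nat)) => [|l' _]; last by rewrite mnm1E.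
case: (boolP (_ == k)) => lk.
  by rewrite (bigD1 l) // eqxx big1 // => l' /andP[_ /negbTE]; rewrite eq_sym => ->.
rewrite big1 // => l' /eqP l'k; case: eqP => // ll'.
by case/eqP: lk; rewrite ll'.
Qed.

(** Each Leibniz term takes one factor from every row, so all terms have the sum of the row
    degrees. *)
Lemma multihomogeneous_det N (A : 'M[M]_N) (d : 'I_N -> nat -> nat) :
  (forall a b, of_multidegree (d a) (A a b)) -> multihomogeneous (\det A).
Proof.
move=> dA; exists (fun k => \sum_a d a k)%N.
apply: of_multidegree_sum => s.
have dprod : of_multidegree (fun k => \sum_a d a k)%N (\prod_i A i (s i)).
  by apply: of_multidegree_prod => a; apply: dA.
by rewrite mulr_sign; case: ifP => // _; rewrite -scaleN1r; apply: of_multidegreeZ.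
Qed.

End Multidegree.

(** The map g lists its image in another order, so c is the sign of a permutation. It is independent
    of X and can therefore be a coefficient of a polynomial. *)
Lemma det_cols_enum (K : fieldType) n k (g : 'I_k -> 'I_n) : injective g ->
  exists c : K, forall X : nat -> 'I_n -> K,
    \det (\matrix_(a < k, b < k) X a (g b)) =
    c * \det (\matrix_(a < #|[set g b | b : 'I_k]|, b < #|[set g b | b : 'I_k]|)
                X a (enum_val b)).
Proof.
move=> gI; set J := [set g b | b : 'I_k].
have cJ : #|J| = k by rewrite card_imset // card_ord.
have gJ b : exists c : 'I_#|J|, enum_val c = g b.
  have gbJ : g b \in J by apply: imset_f.
  by exists (enum_rank_in gbJ (g b)); rewrite enum_rankK_in.
have hI : injective (@enum_val _ (mem J)) by apply: enum_val_inj.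
(* Generalising the enumeration and then the cardinal of J allows k to replace it in the types of
   the matrices. *)
move: (@enum_val _ (mem J)) gJ hI; rewrite -/J.
move: #|J| cJ => k' ek; subst k' => h gh hI.
have [s sP] := fin_all_exists gh.
have sI : injective s by move=> b b' e; apply: gI; rewrite -!sP e.
exists ((-1) ^+ perm sI) => X; set B := \matrix_(_, _) X _ (h _).
have -> : \matrix_(a < k, b < k) X a (g b) = col_perm (perm sI) B.
  by apply/matrixP => a b; rewrite !mxE permE sP.
by rewrite col_permE det_mulmx det_perm odd_permV mulrC.
Qed.

(** * Contractions of Pluecker vectors and closed rank conditions *)

Section Contraction.
Variables (K : fieldType) (V : vectType K) (n : nat) (e : n.-tuple V).
Hypothesis be : basis_of fullv e.
Implicit Types (F G : 'I_n.+1 -> {vspace V}) (I J : {set 'I_n}).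

(* Up to sign the Pluecker coordinate of (I minus z) plus y, or 0 if y is in I
   minus z: the contraction of the Pluecker vector of F by the other elements of I. *)
Definition contraction_coord F I (z y : 'I_n) : K :=
  \det (\matrix_(a < #|I|, b < #|I|)
     coord e (if enum_val b == z then y else enum_val b) (vbasis (F (inord #|I|)))`_a).

Definition contraction F I z : V := \sum_(y < n) contraction_coord F I z y *: e`_y.

Lemma coord_contraction F I z y : coord e y (contraction F I z) = contraction_coord F I z y.
Proof. by rewrite coord_sum_free // (basis_free be). Qed.

Lemma contraction_coordE F I z : contraction_coord F I z z = plucker e F I.
Proof.
congr (\det _); apply/matrixP => a b; rewrite !mxE.
by case: eqP => // ->.
Qed.

Lemma contraction_coord_eq0 F I z y : z \in I -> y \in I -> y != z ->
  contraction_coord F I z y = 0.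
Proof.
move=> zI yI yz; rewrite /contraction_coord -det_tr.
apply: (@determinant_alternate _ _ _ (enum_rank_in zI z) (enum_rank_in zI y)).
  by apply: contraNneq yz => h; rewrite -(enum_rankK_in zI yI) -h enum_rankK_in.
by move=> a; rewrite !mxE !enum_rankK_in // eqxx (negbTE yz).
Qed.

(** Only the column of z depends on y. Expansion along it writes the contraction as a combination of
    the basis vectors of F, with cofactors as coefficients. *)
Lemma mem_contraction F I z : z \in I -> \dim (F (inord #|I|)) = #|I| ->
  contraction F I z \in F (inord #|I|).
Proof.
move=> zI dF; pose w := vbasis (F (inord #|I|)); set b0 := enum_rank_in zI z.
have b0z : enum_val b0 = z by rewrite enum_rankK_in.
pose A y := \matrix_(a < #|I|, b < #|I|)
  coord e (if enum_val b == z then y else enum_val b) w`_a.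
have cofE y a : cofactor (A y) a b0 = cofactor (A z) a b0.
  congr (_ * \det _); apply/matrixP => i j; rewrite !mxE.
  case: eqP => // h; case/eqP: (neq_lift b0 j).
  by apply: enum_val_inj; rewrite b0z h.
have -> : contraction F I z = \sum_(a < #|I|) cofactor (A z) a b0 *: w`_a.
  transitivity (\sum_(y < n) \sum_(a < #|I|)
      (cofactor (A z) a b0 * coord e y w`_a) *: e`_y).
    apply: eq_bigr => y _; rewrite -scaler_suml; congr (_ *: _).
    rewrite /contraction_coord (expand_det_col _ b0); apply: eq_bigr => a _.
    by rewrite [cofactor _ _ _]cofE !mxE b0z eqxx mulrC.
  rewrite exchange_big; apply: eq_bigr => a _.
  rewrite [in RHS](coord_basis be (memvf w`_a)) scaler_sumr.
  by apply: eq_bigr => y _; rewrite scalerA.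
apply: memv_suml => a _; apply: memvZ; apply: vbasis_mem; apply: mem_nth.
by rewrite size_tuple dF.
Qed.

(** If replacing z by y repeats a column, the zero polynomial works; otherwise a signed variable
    indexed by a set of the same size as I does. *)
Lemma contraction_poly I z y : exists P : {mpoly K[#|{set 'I_n}|]},
  of_multidegree (fun k => #|I| == k) P /\
  forall F, P.@[plucker_point e F] = contraction_coord F I z y.
Proof.
pose g (b : 'I_#|I|) := if enum_val b == z then y else enum_val b.
case: (boolP (injectiveb g)) => [/injectiveP gI|/injectivePn[b [b' bb' gbb']]].
  have [c cP] := det_cols_enum K gI; set J := [set _ | _ : _] in cP.
  have cJ : #|J| = #|I| by rewrite card_imset // card_ord.
  exists (c *: 'X_(enum_rank J)); split.
    by apply: of_multidegreeZ; have := @of_multidegreeX K n (enum_rank J); rewrite enum_rankK cJ.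
  move=> F; rewrite mevalZ mevalXU /plucker_point enum_rankK.
  rewrite /contraction_coord (cP (fun a y => coord e y (vbasis (F (inord #|I|)))`_a)).
  by have -> : inord #|I| = inord #|J| :> 'I_n.+1 by rewrite cJ.
exists 0; split=> [m|F]; first by rewrite msupp0.
rewrite meval0 /contraction_coord -det_tr (determinant_alternate bb') // => a.
by rewrite !mxE -/(g b) -/(g b') gbb'.
Qed.

Definition coord_space I : {vspace V} := <<[seq e`_(y : 'I_n) | y <- enum I]>>%VS.

Lemma coord_coord_space I v y : v \in coord_space I -> y \notin I -> coord e y v = 0.
Proof.
move=> vI yI; have fe := basis_free be.
suff /subvP/(_ v vI) : (coord_space I <= lker (linfun (coord e y : V -> K^o)))%VS.
  by rewrite memv_ker lfunE => /eqP.
apply/span_subvP => _ /mapP[x + ->]; rewrite mem_enum => xI.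
have /negbTE xy : x != y by apply: contraNneq yI => <-.
by rewrite memv_ker lfunE /= coord_free // xy.
Qed.

Lemma dim_coord_space I : \dim (coord_space I) = #|I|.
Proof.
have fe := basis_free be.
have -> : #|I| = size [seq e`_(y : 'I_n) | y <- enum I] by rewrite size_map cardE.
apply/eqP; rewrite -/(free _).
have eE : [seq e`_(y : 'I_n) | y <- enum 'I_n] = e.
  rewrite (map_comp (nth 0 e) val) val_enum_ord.
  by have := mkseq_nth 0 e; rewrite size_tuple.
have : free ([seq e`_(y : 'I_n) | y <- enum I] ++ [seq e`_(y : 'I_n) | y <- enum (~: I)]).
  rewrite -map_cat (@perm_free _ _ _ e) // -[X in perm_eq _ X]eE; apply: perm_map.
  apply: uniq_perm; rewrite ?enum_uniq ?cat_uniq ?enum_uniq //= ?andbT.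
    apply/hasPn => y; rewrite !mem_enum inE; exact: id.
  by move=> y; rewrite mem_cat !mem_enum inE orbN.
exact: catl_free.
Qed.

(** A relation between the rows gives a vector of the coordinate space whose coordinates on I
    vanish, hence the zero vector. *)
Lemma plucker_neq0 F I : F (inord #|I|) = coord_space I -> plucker e F I != 0.
Proof.
move=> FI; apply/det0P => -[v v0 vM]; case/eqP: v0.
have dF : \dim (F (inord #|I|)) = #|I| by rewrite FI dim_coord_space.
set w := vbasis (F (inord #|I|)) in vM *.
have fw : free w := basis_free (vbasisP _).
have sw : size w == #|I| by rewrite size_tuple dF.
have /freeP fw' : free (Tuple sw) by [].
have v0 : \sum_(a < #|I|) v 0 a *: w`_a = 0.
  have uF : \sum_(a < #|I|) v 0 a *: w`_a \in coord_space I.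
    rewrite -FI; apply: memv_suml => a _; apply: memvZ; apply: vbasis_mem.
    by apply: mem_nth; rewrite (eqP sw).
  rewrite (coord_basis be (memvf (\sum_a _))) big1 // => y _.
  case: (boolP (y \in I)) => yI; last by rewrite (coord_coord_space uF yI) scale0r.
  move/rowP/(_ (enum_rank_in yI y)): vM; rewrite !mxE => vM.
  rewrite linear_sum /= [X in X *: _](_ : _ = 0) ?scale0r // -[RHS]vM.
  by apply: eq_bigr => a _; rewrite linearZ !mxE enum_rankK_in.
by apply/rowP => a; rewrite mxE; apply: (fw' (v 0)).
Qed.

(** The coordinates off I vanish because the contraction lies in F, those in I other than z because
    of a repeated column. *)
Lemma contraction_coord_space F I z : F (inord #|I|) = coord_space I -> z \in I ->
  contraction F I z = plucker e F I *: e`_z.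
Proof.
move=> FI zI; rewrite /contraction (bigD1 z) //= contraction_coordE big1 ?addr0 // => y yz.
case: (boolP (y \in I)) => yI; first by rewrite contraction_coord_eq0 // scale0r.
rewrite -coord_contraction (@coord_coord_space I) ?scale0r // -FI.
by apply: mem_contraction; rewrite // FI dim_coord_space.
Qed.

Lemma dim_ge_minor N (W : {vspace V}) (w : 'I_N -> V) (g : 'I_N -> 'I_n) :
  (forall a, w a \in W) ->
  \det (\matrix_(a < N, b < N) coord e (g b) (w a)) != 0 -> (N <= \dim W)%N.
Proof.
move=> wW d0; have fw : free (mktuple w).
  apply/freeP => v v0 a; set B := \matrix_(_, _) _ in d0.
  suff : \row_a v a *m B = 0.
    have Bu : B \in unitmx by rewrite unitmxE unitfE.
    by move=> h; have /rowP/(_ a) := mulmxK Bu (\row_a v a); rewrite h mul0mx !mxE.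
  apply/rowP => b; rewrite !mxE; transitivity (coord e (g b) (\sum_(i < N) v i *: (mktuple w)`_i)).
    rewrite linear_sum; apply: eq_bigr => i _; rewrite linearZ !mxE.
    by rewrite -tnth_nth tnth_mktuple.
  by rewrite v0 linear0.
have /eqnP := fw; rewrite size_tuple => <-; apply: dimvS.
by apply/span_subvP => _ /mapP[a _ ->].
Qed.

(* The separating polynomial is the minor on the columns I :|: D of the contractions
   of F i by z in I and of the images under u of the contractions of F j by rho z,
   z in D; at a coordinate flag its matrix is diagonal. *)
Lemma rank_semicontinuous (u : 'End(V)) (Z : ('I_n.+1 -> {vspace V}) -> Prop) F I J
    (D : {set 'I_n})
    (rho : 'I_n -> 'I_n) :
  F (inord #|I|) = coord_space I -> F (inord #|J|) = coord_space J ->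
  [disjoint I & D] ->
  (forall z, z \in D -> rho z \in J /\ u e`_(rho z) = e`_z) ->
  (forall G, Z G -> complete_flag G /\
     (\dim (G (inord #|I|) + u @: G (inord #|J|)) < #|I| + #|D|)%N) ->
  ~ zariski_closure e Z F.
Proof.
move=> FI FJ dis rhoP ZG [_ Fclos].
set S := I :|: D; have cS : #|S| = (#|I| + #|D|)%N by rewrite cardsU disjoint_setI0 // cards0 subn0.
pose row G z := if z \in I then contraction G I z else u (contraction G J (rho z)).
pose d (z : 'I_n) : nat -> nat := fun k => (if z \in I then #|I| else #|J|) == k.
have ex (ab : 'I_#|S| * 'I_#|S|) : exists P : {mpoly K[#|{set 'I_n}|]},
    of_multidegree (d (enum_val ab.1)) P /\
    forall G, P.@[plucker_point e G] = coord e (enum_val ab.2) (row G (enum_val ab.1)).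
  case: ab => a b /=; rewrite /d /row; case: (boolP (_ \in I)) => zI.
    have [P [dP PE]] := contraction_poly I (enum_val a) (enum_val b).
    by exists P; split=> // G; rewrite PE coord_contraction.
  have [L LP] := fin_all_exists (fun y => contraction_poly J (rho (enum_val a)) y).
  exists (\sum_(y < n) coord e (enum_val b) (u e`_y) *: L y); split.
    by apply: of_multidegree_sum => y; apply: of_multidegreeZ; case: (LP y).
  move=> G; rewrite /contraction !linear_sum /=; apply: eq_bigr => y _.
  by rewrite mevalZ (LP y).2 !linearZ /= mulrC.
have [L LP] := fin_all_exists ex.
pose A := \matrix_(a < #|S|, b < #|S|) L (a, b).
have AE G : (\det A).@[plucker_point e G] =
    \det (\matrix_(a < #|S|, b < #|S|) coord e (enum_val b) (row G (enum_val a))).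
  rewrite -det_map_mx; congr (\det _); apply/matrixP => a b; rewrite !mxE.
  exact: (LP (a, b)).2.
have : (\det A).@[plucker_point e F] = 0.
  apply: Fclos.
    apply: (@multihomogeneous_det _ _ _ _ (fun a => d (enum_val a))) => a b.
    by rewrite mxE; apply: (LP (a, b)).1.
  move=> G /ZG[[dG _] lt_dim]; apply/eqP; rewrite AE; apply: contraTT lt_dim => d0.
  rewrite -leqNgt -cS; apply: dim_ge_minor d0 => a.
  have := enum_valP a; rewrite in_setU /row; case: ifP => [zI _|_ /= /rhoP[zJ _]].
    apply: (subvP (addvSl _ _)); apply: mem_contraction => //.
    by rewrite dG inordK ?card_setI_ord.
  apply: (subvP (addvSr _ _)); apply: memv_img; apply: mem_contraction => //.
  by rewrite dG inordK ?card_setI_ord.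
(* The row of z is a multiple of e_z: directly for z in I, and for z in D because u sends e_(rho z)
   to e_z. *)
pose D0 := \row_(a < #|S|) if enum_val a \in I then plucker e F I else plucker e F J.
rewrite AE (_ : \matrix_(_, _) _ = diag_mx D0); last first.
  apply/matrixP => a b; rewrite !mxE.
  have -> : row F (enum_val a) = D0 0 a *: e`_(enum_val a).
    have := enum_valP a; rewrite in_setU /row mxE; case: ifP => [zI _|_ /= /rhoP[zJ uz]].
      exact: contraction_coord_space.
    by rewrite (contraction_coord_space FJ) // linearZ /= uz.
  rewrite linearZ /= coord_free ?(basis_free be) // (inj_eq enum_val_inj) eq_sym.
  by rewrite mxE mulr_natr.
rewrite det_diag => /eqP; apply/negP/prodf_neq0 => a _; rewrite mxE.
by case: ifP => _; apply: plucker_neq0.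
Qed.

End Contraction.

Lemma card_ord_cnt n (P : pred nat) : #|[set z : 'I_n | P z]| = cnt n P.
Proof.
rewrite -sum1_card /cnt big_mkord [LHS]big_mkcond; apply: eq_bigr => z _.
by rewrite inE; case: (P z).
Qed.

(** * Rank inequalities on a component *)

Section Necessity.
Variables (K : fieldType) (V : vectType K) (r s : nat) (u : 'End(V)).
Variables (e : (r + s).-tuple V) (T : seq (seq nat)).
Hypotheses (s0 : (0 < s)%N) (sr : (s <= r)%N) (he : jordan_basis r s u e).
Let n := (r + s)%N.

Lemma limg_sub_lker (U : {vspace V}) : (u @: U <= lker u)%VS.
Proof.
have [be u0 u1] := he; apply: subv_trans (limgS u (subvf U)) _.
rewrite -(span_basis be) limg_span; apply/span_subvP => _ /mapP[_ /(nthP 0)[k + <-] ->].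
rewrite size_tuple memv_ker => kn; case: (ltnP k r) => kr; first by rewrite u0 ?linear0.
by rewrite -(subnKC kr) u1 ?u0 //; lia.
Qed.

(** Since u V_k lies in the kernel of u on V_k, adding it to V_i costs at most the growth of that
    kernel from V_i to V_k, which is first(i, k]. Passing from u V_k to u V_j costs at most the
    growth of the rank, second(k, j]. *)
Lemma stratum_dim (hT : standard (two_columns r s) T) G i k j :
  springer_stratum u T G -> (i <= k <= j)%N -> (j <= n)%N ->
  (\dim (G (inord i : 'I_n.+1) + u @: G (inord j)) <=
     i + (nb_first n (second T) i k + nb_second n (second T) k j))%N.
Proof.
move=> [[[dG mG] uG] yG] ikj jn; have [rowT _] := hT.
have dimG m : (m <= n)%N -> \dim (G (inord m)) = m by move=> mn; rewrite dG inordK.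
have dimu m : (m <= n)%N -> \dim (u @: G (inord m)) = nb_second n (second T) 0 m.
  move=> mn; have := yG (inord m); rewrite inordK // (subshape_two_columns s0 sr hT) //.
  apply: dim_limg_two_columns.
  by have := beta_alpha s0 sr hT m; rewrite (betaE s0 sr hT) (alphaE s0 sr hT).
have [kn in_] : (k <= n /\ i <= n)%N by lia.
have ker m : (m <= n)%N -> (\dim (G (inord m) :&: lker u) + nb_second n (second T) 0 m = m)%N.
  by move=> mn; rewrite -(dimu m mn) limg_ker_dim dimG.
have Gik : (G (inord i) <= G (inord k))%VS by apply: mG; rewrite !inordK //; lia.
have Gkj : (G (inord k) <= G (inord j))%VS by apply: mG; rewrite !inordK //; lia.
set Wk := (G (inord i) + u @: G (inord k))%VS.
have dWk : (\dim Wk + \dim (G (inord i) :&: lker u) <= i + \dim (G (inord k) :&: lker u))%N.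
  rewrite -[X in (_ <= X + _)%N](dimG i in_) -[X in (_ <= X)%N]dimv_sum_cap.
  rewrite leq_add //; apply: dimvS.
    by apply: addvS => //; rewrite subv_cap uG limg_sub_lker.
  by rewrite capvA; apply: capvS => //; rewrite subv_cap subvv.
have dWj : (\dim (Wk + u @: G (inord j)) + \dim (u @: G (inord k)) <=
    \dim Wk + \dim (u @: G (inord j)))%N.
  rewrite -[X in (_ <= X)%N]dimv_sum_cap leq_add2l; apply: dimvS.
  by rewrite subv_cap addvSr limgS.
have : (\dim (G (inord i) + u @: G (inord j)) <= \dim (Wk + u @: G (inord j)))%N.
  by apply: dimvS; apply: addvS => //; apply: addvSl.
have := ker i in_; have := ker k kn; rewrite dimu // dimu // in dWj *.
have := @nb_first_second n (second T) i k kn; move: dWj.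
have := @nb_second_split n (second T) 0 i k; have := @nb_second_split n (second T) 0 k j.
lia.
Qed.

(** Each row p of T' counted by s_(j/i)(T') gives a vector e_p = u e_(r+p) of u V_j outside V_i. If
    the inequality failed, dim (V_i + u V_j) at F_T' would exceed the bound on the stratum, for the
    k supplied by [s_std_ge]. *)
Lemma component_rank_le T' (hT : standard (two_columns r s) T)
    (hT' : row_standard (two_columns r s) T') :
  springer_component e u T (tableau_flag r s e T') ->
  forall i j : nat, (i < j)%N -> (j <= n)%N -> (s_rowstd T' i j <= s_std T i j)%N.
Proof.
move=> [[[dF _] _] clos] i j ij jn; rewrite leqNgt; apply/negP => lt_s.
have [be u0 u1] := he.
pose pos y := if (y < r)%N then entry T' y 0 else entry T' (y - r) 1.
pose I m := [set y : 'I_n | (pos y <= m)%N].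
have FI m : (m <= n)%N -> tableau_flag r s e T' (inord m) = coord_space e (I m).
  move=> mn; rewrite /tableau_flag /coord_space inordK //; apply/eq_span => v.
  rewrite mem_cat; apply/orP/mapP => [[]/mapP[p]|[y + ->]].
  - rewrite mem_filter mem_iota => /andP[pm /= pr] ->.
    have pn : (p < n)%N by rewrite /n; lia.
    by exists (Ordinal pn); rewrite // mem_enum inE /pos pr.
  - rewrite mem_filter mem_iota => /andP[pm /= pr] ->.
    have pn : (r + p < n)%N by rewrite /n; lia.
    by exists (Ordinal pn); rewrite // mem_enum inE /pos /= ifF ?addKn //; lia.
  rewrite mem_enum inE /pos; have := ltn_ord y; case: (ltnP y r) => yr yn ym.
    by left; apply: map_f; rewrite mem_filter mem_iota ym.
  right; apply/mapP; exists (y - r)%N; last by rewrite subnKC.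
  by rewrite mem_filter mem_iota ym /= /n in yn *; lia.
have cI m : (m <= n)%N -> #|I m| = m.
  by move=> mn; rewrite -(dim_coord_space be) -FI // dF inordK.
pose D := [set y : 'I_n | (y < s)%N && (i < entry T' y 0)%N && (entry T' y 1 <= j)%N].
have cD : #|D| = s_rowstd T' i j.
  rewrite (@card_ord_cnt n (fun y => (y < s)%N && (i < entry T' y 0)%N && (entry T' y 1 <= j)%N)).
  rewrite (@eq_cnt _ _ (fun y => (y < s)%N && ((i < entry T' y 0) && (entry T' y 1 <= j))%N)).
    rewrite cnt_widen ?leq_addl // cntE /s_rowstd (size_col1 sr hT').
    apply: eq_in_count => p; rewrite mem_iota add0n /= => ps.
    have pr : (p < r)%N by lia.
    by rewrite (nth_col0 sr hT') // (nth_col1 sr hT') // (lt_row sr hT').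
  by move=> y yn; rewrite andbA.
have [k ikj le_s] := s_std_ge s0 sr hT (ltnW ij).
have in_ : (i <= n)%N by lia.
(* Here rho y = r + y; the default of [insubd] is reached only for y >= s, outside [D]. *)
apply: (@rank_semicontinuous _ _ _ e be u (springer_stratum u T) (tableau_flag r s e T')
  (I i) (I j) D (fun y => insubd y (r + y)%N)) clos.
- by rewrite cI // FI.
- by rewrite cI // FI.
- rewrite disjoint_subset; apply/subsetP => y; rewrite !inE /pos => yi.
  apply/negP => /andP[/andP[ys iy] _]; move: yi.
  by rewrite (leq_trans ys sr) leqNgt iy.
- move=> z; rewrite !inE => /andP[/andP[zs iz] zj].
  have zn : (r + z < n)%N by rewrite ltn_add2l.
  by rewrite /pos val_insubd zn ifF ?addKn ?u1 //; lia.
move=> G ZG; split; first by case: ZG => -[].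
rewrite !cI // cD; apply: leq_ltn_trans (stratum_dim hT ZG ikj jn) _.
by rewrite ltn_add2l (leq_ltn_trans le_s).
Qed.

End Necessity.

Local Open Scope complex_scope.

Theorem theorem2p1 (R : realType) (n r s : nat) (V : vectType R[i])
    (u : 'End(V)) (e : n.-tuple V) (T T' : seq (seq nat))
    (hs : (1 <= s)%N) (hsr : (s <= r)%N) (hn : n = (r + s)%N)
    (hdim : \dim {:V} = n)
    (hnil : nilpotent_end u)
    (hY : young_diagram_of u fullv (two_columns r s))
    (he : jordan_basis r s u e)
    (hT : standard (two_columns r s) T)
    (hT' : row_standard (two_columns r s) T') :
  springer_component e u T (tableau_flag r s e T') <->
  (forall i j : nat, (i < j)%N -> (j <= n)%N ->
     (s_rowstd T' i j <= s_std T i j)%N).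
Proof.
subst n; split; first exact: component_rank_le.
exact: dominated_component.
Qed.
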